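(* Let \[ \mathbb{1}_{\mathscr{G}^0}\to\mathscr{N}\to\mathscr{G}\xrightarrow{\,f\,}\mathscr{H}\to 1 \] be a split short exact sequence of quiver skew braces, with splitting $s\colon\mathscr{H}\to\mathscr{G}$, $fs=\mathrm{id}_{\mathscr{H}}$. Identify $\mathscr{H}$ with its isomorphic image $s(\mathscr{H})\subseteq\mathscr{G}$, so that $\mathscr{H}^0\subseteq\mathscr{N}^0=\mathscr{G}^0$. Then \[ \mathscr{G}\cong\mathscr{N}\rtimes\mathscr{H}\ltimes\mathscr{N} \] as quiver skew braces, where the right-hand side is the categorical semidirect product formed with the following data: (i) the actions $\triangleright,\triangleleft$ are given by conjugation of loops in $\mathscr{G}$: $h\triangleright\ell=h\ell h^{-1}$ and $\ell\triangleleft h=h^{-1}\ell h$; (ii) the right actions $\varphi$ are the additive right conjugations in the additive star-groups: $\varphi_h(a)=-h+a+h$; (iii) $\gamma$ is the restriction of the action $\rightharpoonup$ in $\mathscr{G}$: $\gamma_h(a)=-h+ha$ for all $h\in\mathscr{H}^1$, $a\in\mathrm{St}_{\mathscr{N}}(\mathfrak{t}(h))$.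
   Context: Groupoids: $\mathscr{G}$ has arrows $\mathscr{G}^1$, vertices $\mathscr{G}^0$, source/target $\mathfrak{s},\mathfrak{t}$; $xy$ is defined when $\mathfrak{t}(x)=\mathfrak{s}(y)$; $\mathscr{G}_\lambda$ is the group of loops at $\lambda$; $\mathrm{St}_{\mathscr{G}}(\lambda)=\{x:\mathfrak{s}(x)=\lambda\}$. A quiver skew brace is a groupoid with, for every vertex $\lambda$, a (not necessarily abelian) group operation $+=+_\lambda$ on $\mathrm{St}_{\mathscr{G}}(\lambda)$, such that $a(b+c)=ab-a+ac$ whenever $\mathfrak{t}(a)=\mathfrak{s}(b)=\mathfrak{s}(c)$ (then $1_\lambda$ is neutral for $+_\lambda$). Equivalently, each star has a heap structure $\langle x,y,z\rangle=x-y+z$ (a heap is a ternary operation with $\langle\langle a,b,c\rangle,d,e\rangle=\langle a,b,\langle c,d,e\rangle\rangle$, $\langle a,b,b\rangle=a$, $\langle a,a,b\rangle=b$) with $a\langle b,c,d\rangle=\langle ab,ac,ad\rangle$; the group is recovered by $x+_\lambda y=\langle x,1_\lambda,y\rangle$. Put $a\rightharpoonup b=-a+ab$. A morphism is a groupoid morphism $f=(f^1,f^0)$ inducing homomorphisms of the additive star-groups. Its kernel is the wide subgroupoid of arrows mapped to units. Split short exact sequence: $\mathscr{N}=\ker f$ (with the induced structure), $f$ induces an isomorphism $\mathscr{G}/\mathscr{N}\cong\mathscr{H}$, and $s$ is a morphism of quiver skew braces with $fs=\mathrm{id}$. Here $\mathscr{G}/\mathscr{N}$ has as vertices the connected components of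 $\mathscr{N}$, and as arrows the classes for $x\sim iyj$, $i,j\in\mathscr{N}^1$. In particular each connected component of $\mathscr{N}$ contains exactly one vertex of $\mathscr{H}$. $\mathbb{1}_{\mathscr{G}^0}$ denotes the groupoid of units. Categorical semidirect product. Let $\mathscr{N},\mathscr{H}$ be quiver skew braces with $\mathscr{H}^0\subseteq\mathscr{N}^0$ and every connected component of $\mathscr{N}$ containing exactly one vertex of $\mathscr{H}$. Let $\underline{\mathscr{N}}$ be the bundle of groups of loops of $\mathscr{N}$ at vertices of $\mathscr{H}^0$. The data are: - a left action $\triangleright$ of $(\mathscr{H},\cdot)$ on $(\underline{\mathscr{N}},\cdot)$, i.e. group isomorphisms $h\triangleright(-)\colon\mathscr{N}_{\mathfrak{t}(h)}\to\mathscr{N}_{\mathfrak{s}(h)}$ with $(hk)\triangleright x=h\triangleright(k\triangleright x)$ and units acting trivially; put $x\triangleleft h=h^{-1}\triangleright x$; - for each $\lambda\in\mathscr{H}^0$, a right action $\varphi$ of $(\mathrm{St}_{\mathscr{H}}(\lambda),+)$ on $(\mathrm{St}_{\mathscr{N}}(\lambda),+)$ by group automorphisms ($\varphi_{h+k}=\varphi_k\varphi_h$); - an action $\gamma$ of $(\mathscr{H},\cdot)$, with $\gamma_h\colon\mathrm{St}_{\mathscr{N}}(\mathfrak{t}(h))\to\mathrm{St}_{\mathscr{N}}(\mathfrak{s}(h))$ additive homomorphisms, $\gamma_{hk}=\gamma_h\gamma_k$, $\gamma_{1}=\mathrm{id}$. Set \[\mathrm{T}_{h_1,h_2,h_3}(b_1,b_2,b_3)=\gamma^{-1}_{\langle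 h_1,h_2,h_3\rangle}\langle\varphi_{h_3}\varphi_{h_2}^{-1}\gamma_{h_1}(b_1),\varphi_{h_3}\varphi_{h_2}^{-1}\gamma_{h_2}(b_2),\gamma_{h_3}(b_3)\rangle.\] The data are required to satisfy $\mathrm{T}_{h_1,h_2,h_3}((\ell\triangleleft h_1)b_1,(\ell\triangleleft h_2)b_2,(\ell\triangleleft h_3)b_3)=(\ell\triangleleft\langle h_1,h_2,h_3\rangle)\,\mathrm{T}_{h_1,h_2,h_3}(b_1,b_2,b_3)$ for all $\lambda\in\mathscr{H}^0$, $h_i\in\mathrm{St}_{\mathscr{H}}(\lambda)$, $b_i\in\mathrm{St}_{\mathscr{N}}(\mathfrak{t}(h_i))$, $\ell\in\mathscr{N}_\lambda$. The product $\mathscr{N}\rtimes\mathscr{H}\ltimes\mathscr{N}$ has vertices $\mathscr{N}^0$ and arrows the classes $a\bar\otimes h\bar\otimes b$ of composable triples ($a,b\in\mathscr{N}^1$, $h\in\mathscr{H}^1$, $\mathfrak{t}(a)=\mathfrak{s}(h)$, $\mathfrak{t}(h)=\mathfrak{s}(b)$) under the equivalence relation generated by $a\underline{b}\otimes h\otimes\underline{c}d\sim a\underline{b}(h\triangleright\underline{c})\otimes h\otimes d\sim a\otimes h\otimes(\underline{b}\triangleleft h)\underline{c}d$, with $\underline{b},\underline{c}\in\underline{\mathscr{N}}$. The source is $\mathfrak{s}(a)$ and the target is $\mathfrak{t}(b)$. The multiplication is $(a_1\bar\otimes h_1\bar\otimes b_1)(a_2\bar\otimes h_2\bar\otimes b_2)=a_1(h_1\triangleright(b_1a_2))\bar\otimes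 h_1h_2\bar\otimes b_2$ (where $b_1a_2$ is a loop at a vertex of $\mathscr{H}^0$). The unit at $\lambda$ is $a\bar\otimes 1_\mu\bar\otimes a^{-1}$, with $\mu\in\mathscr{H}^0$ the vertex in the component of $\lambda$ in $\mathscr{N}$ and $a\in\mathscr{N}(\lambda,\mu)$ arbitrary. The additive structure on each star is given by the heap operation \[\langle a_1\bar\otimes h_1\bar\otimes b_1,\,a_2\bar\otimes h_2\bar\otimes b_2,\,a_3\bar\otimes h_3\bar\otimes b_3\rangle=a_1\bar\otimes\langle h_1,h_2,h_3\rangle\bar\otimes\mathrm{T}_{h_1,h_2,h_3}\big(b_1,((a_1^{-1}a_2)\triangleleft h_2)b_2,((a_1^{-1}a_3)\triangleleft h_3)b_3\big).\] *)

(* Defs.v *)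
From Stdlib Require Import Relations.
From mathcomp Require Import all_boot generic_quotient.
From mathcomp Require Import boolp.

Set Implicit Arguments.
Unset Strict Implicit.
Unset Printing Implicit Defensive.

Declare Scope qsb_scope.
Delimit Scope qsb_scope with qsb.
Local Open Scope quotient_scope.
Local Open Scope qsb_scope.

(* The partial operations are total functions: [mul x y] is meaningful only if
   [tgt x = src y]. No axiom, and no condition on morphisms, constrains it
   elsewhere. *)
Record groupoid := Groupoid {
  vert : Type;
  arr :> Type;
  src : arr -> vert;
  tgt : arr -> vert;
  one : vert -> arr;
  inv : arr -> arr;
  mul : arr -> arr -> arr;
  src_one : forall v, src (one v) = v;
  tgt_one : forall v, tgt (one v) = v;
  src_inv : forall x, src (inv x) = tgt x;
  tgt_inv : forall x, tgt (inv x) = src x;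
  src_mul : forall x y, tgt x = src y -> src (mul x y) = src x;
  tgt_mul : forall x y, tgt x = src y -> tgt (mul x y) = tgt y;
  mulA : forall x y z, tgt x = src y -> tgt y = src z ->
    mul x (mul y z) = mul (mul x y) z;
  mul1x : forall x, mul (one (src x)) x = x;
  mulx1 : forall x, mul x (one (tgt x)) = x;
  mulVx : forall x, mul (inv x) x = one (tgt x);
  mulxV : forall x, mul x (inv x) = one (src x) }.

Notation "x * y" := (mul x y) : qsb_scope.
Notation "x ^-1" := (inv x) : qsb_scope.

Definition loop_at (G : groupoid) (v : vert G) (x : G) :=
  src x = v /\ tgt x = v.

Definition connected (G : groupoid) (v w : vert G) :=
  exists x : G, src x = v /\ tgt x = w.

(* A groupoid with a group structure on the star [src x = v] of every vertex
   [v]; again, [add x y] is meaningful only if [src x = src y]. That [zero v]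
   is [one v] follows from skew left distributivity, see [zero_one]. *)
Record star_groupoid := StarGroupoid {
  groupoid_of :> groupoid;
  zero : vert groupoid_of -> groupoid_of;
  opp : groupoid_of -> groupoid_of;
  add : groupoid_of -> groupoid_of -> groupoid_of;
  src_zero : forall v, src (zero v) = v;
  src_opp : forall x, src (opp x) = src x;
  src_add : forall x y, src x = src y -> src (add x y) = src x;
  addA : forall x y z, src x = src y -> src y = src z ->
    add x (add y z) = add (add x y) z;
  add0x : forall x, add (zero (src x)) x = x;
  addx0 : forall x, add x (zero (src x)) = x;
  addNx : forall x, add (opp x) x = zero (src x);
  addxN : forall x, add x (opp x) = zero (src x) }.

Notation "x + y" := (add x y) : qsb_scope.
Notation "- x" := (opp x) : qsb_scope.
Notation "x - y" := (add x (opp y)) : qsb_scope.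

Definition heap (G : star_groupoid) (x y z : G) : G := x - y + z.

Definition skew_left_distributive (G : star_groupoid) :=
  forall a b c : G, tgt a = src b -> src b = src c ->
    a * (b + c) = a * b - a + a * c.

Record qsb := QSB {
  star_groupoid_of :> star_groupoid;
  skew_distr : skew_left_distributive star_groupoid_of }.

Record groupoid_mor (G H : groupoid) := GroupoidMor {
  mor0 : vert G -> vert H;
  mor1 :> G -> H;
  mor_src : forall x, src (mor1 x) = mor0 (src x);
  mor_tgt : forall x, tgt (mor1 x) = mor0 (tgt x);
  mor_mul : forall x y, tgt x = src y -> mor1 (x * y) = mor1 x * mor1 y }.

Record star_mor (G H : star_groupoid) := StarMor {
  groupoid_mor_of :> groupoid_mor G H;
  mor_add : forall x y, src x = src y ->
    groupoid_mor_of (x + y) = groupoid_mor_of x + groupoid_mor_of y }.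

Definition is_iso (G H : star_groupoid) (f : star_mor G H) :=
  exists g : star_mor H G,
    (cancel (mor0 f) (mor0 g) /\ cancel (mor0 g) (mor0 f)) /\
    (cancel f g /\ cancel g f).

Definition isomorphic (G H : star_groupoid) :=
  exists f : star_mor G H, is_iso f.

Ltac st_rw :=
  repeat first
    [ rewrite src_one | rewrite tgt_one | rewrite src_inv | rewrite tgt_inv
    | rewrite src_zero | rewrite src_opp
    | rewrite mor_src | rewrite mor_tgt
    | rewrite src_mul; [ | solve [st_tac] ]
    | rewrite tgt_mul; [ | solve [st_tac] ]
    | rewrite src_add; [ | solve [st_tac] ] ]
with st_tac := st_rw; first [ assumption | congruence ].

Section GroupoidFacts.
Variable G : groupoid.
Implicit Types x y z : G.

Lemma mulKx x y : tgt x = src y -> x^-1 * (x * y) = y.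
Proof. by move=> e; rewrite mulA ?mulVx ?e ?mul1x//; st_tac. Qed.

Lemma mulKVx x y : src x = src y -> x * (x^-1 * y) = y.
Proof. by move=> e; rewrite mulA ?mulxV ?e ?mul1x//; st_tac. Qed.

Lemma mulxK x y : tgt y = src x -> y * x * x^-1 = y.
Proof. by move=> e; rewrite -mulA ?mulxV -?e ?mulx1//; st_tac. Qed.

Lemma mulI x y z : tgt x = src y -> tgt x = src z -> x * y = x * z -> y = z.
Proof. by move=> ey ez /(congr1 (mul x^-1)); rewrite !mulKx. Qed.

Lemma idem_one x : tgt x = src x -> x * x = x -> x = one (src x).
Proof.
move=> e xx; apply: (@mulI x) => //; first by st_tac.
by rewrite xx -e mulx1.
Qed.

Lemma inv_uniq x y : tgt x = src y -> x * y = one (src x) -> y = x^-1.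
Proof.
move=> e h; apply: (@mulI x) => //; first by st_tac.
by rewrite h mulxV.
Qed.

Lemma inv_one v : (one v)^-1 = one v :> G.
Proof.
have e := mul1x (one v : G); rewrite src_one in e.
by symmetry; apply: inv_uniq; rewrite ?e; st_tac.
Qed.

Lemma invK x : x^-1^-1 = x.
Proof. by symmetry; apply: inv_uniq; rewrite ?mulVx; st_tac. Qed.

Lemma invM x y : tgt x = src y -> (x * y)^-1 = y^-1 * x^-1.
Proof.
move=> e; symmetry; apply: inv_uniq; first by st_tac.
rewrite mulA ?mulxK ?mulxV; [|by st_tac..].
by congr one; st_tac.
Qed.

Lemma connected_refl (v : vert G) : connected v v.
Proof. by exists (one v); split; st_tac. Qed.
Lemma connected_sym (v w : vert G) : connected v w -> connected w v.
Proof. by move=> [x [<- <-]]; exists x^-1; split; st_tac. Qed.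
Lemma connected_trans (u v w : vert G) :
  connected u v -> connected v w -> connected u w.
Proof. by move=> [x [<- e]] [y [ey <-]]; exists (x * y); split; st_tac. Qed.

End GroupoidFacts.

Section StarFacts.
Variable G : star_groupoid.
Implicit Types x y z : G.

Lemma addKx x y : src x = src y -> - x + (x + y) = y.
Proof. by move=> e; rewrite addA ?addNx ?e ?add0x//; st_tac. Qed.
Lemma addKVx x y : src x = src y -> x + (- x + y) = y.
Proof. by move=> e; rewrite addA ?addxN ?e ?add0x//; st_tac. Qed.
Lemma addxK x y : src y = src x -> y + x - x = y.
Proof. by move=> e; rewrite -addA ?addxN -?e ?addx0//; st_tac. Qed.
Lemma addxKV x y : src y = src x -> y - x + x = y.
Proof. by move=> e; rewrite -addA ?addNx -?e ?addx0//; st_tac. Qed.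
Lemma addIx x y z : src x = src y -> src x = src z -> x + y = x + z -> y = z.
Proof. by move=> ey ez /(congr1 (add (- x))); rewrite !addKx. Qed.
Lemma addid0 x : x + x = x -> x = zero (src x).
Proof. by move=> e; apply: (@addIx x) => //; [st_tac | rewrite e addx0]. Qed.
Lemma opp_uniq x y : src x = src y -> x + y = zero (src x) -> y = - x.
Proof.
by move=> e h; apply: (@addIx x) => //; [st_tac | rewrite h addxN].
Qed.
Lemma oppK x : - - x = x.
Proof. by symmetry; apply: opp_uniq; [st_tac | rewrite addNx src_opp]. Qed.
Lemma oppD x y : src x = src y -> - (x + y) = - y - x.
Proof.
move=> e; symmetry; apply: opp_uniq; first by st_tac.
by rewrite addA ?addxK ?addxN; [congr zero; st_tac | st_tac..].
Qed.

Lemma src_heap x y z : src x = src y -> src y = src z ->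
  src (heap x y z) = src x.
Proof. by rewrite /heap => *; st_tac. Qed.

Lemma heapA x y z u v :
  src x = src y -> src y = src z -> src z = src u -> src u = src v ->
  heap (heap x y z) u v = heap x y (heap z u v).
Proof. by rewrite /heap => *; rewrite !addA//; st_tac. Qed.

Lemma heapxyy x y : src x = src y -> heap x y y = x.
Proof. exact: addxKV. Qed.
Lemma heapxxy x y : src x = src y -> heap x x y = y.
Proof. by move=> e; rewrite /heap addxN e add0x. Qed.

End StarFacts.

Section MorFacts.
Variables (G H : star_groupoid) (f : star_mor G H).

Lemma mor_one v : f (one v) = one (mor0 f v).
Proof.
rewrite [LHS]idem_one; [by congr one; st_tac | by st_tac |].
rewrite -mor_mul; last by st_tac.
by have := mul1x (one v : G); rewrite src_one => ->.
Qed.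

Lemma mor_inv x : f x^-1 = (f x)^-1.
Proof.
apply: inv_uniq; first by st_tac.
by rewrite -mor_mul ?mulxV ?mor_one; st_tac.
Qed.

Lemma mor_zero v : f (zero v) = zero (mor0 f v).
Proof.
rewrite [LHS]addid0; first by congr zero; st_tac.
rewrite -mor_add //.
by have := add0x (zero v : G); rewrite src_zero => ->.
Qed.

Lemma mor_opp x : f (- x) = - f x.
Proof.
apply: opp_uniq; first by st_tac.
by rewrite -mor_add ?addxN ?mor_zero; st_tac.
Qed.

End MorFacts.

Section QsbFacts.
Variable G : qsb.
Implicit Types a b c d : G.

Lemma zero_one (v : vert G) : zero v = one v :> G.
Proof.
have := @skew_distr G (one v) (zero v) (zero v).
rewrite src_zero tgt_one => /(_ erefl erefl).
have e1 : one v * zero v = zero v :> G.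
  by have := mul1x (zero v : G); rewrite src_zero.
have e0 : zero v + zero v = zero v :> G.
  by have := add0x (zero v : G); rewrite src_zero.
rewrite e0 e1 => e.
have e2 : zero v = - one v :> G.
  rewrite e; have := @addx0 G (zero v - one v).
  have := @add0x G (- one v); rewrite src_opp src_one => -> .
  by rewrite src_opp src_one => ->.
by rewrite -[RHS]oppK -e2; apply: opp_uniq => //; rewrite e0 src_zero.
Qed.

End QsbFacts.

Section GeneratedQuotient.
Variables (T : Type) (R : T -> T -> Prop).

Definition generated : rel {classic T} :=
  fun x y => `[< clos_refl_sym_trans T R x y >].

Lemma generated_refl : reflexive generated.
Proof. by move=> x; apply/asboolP; apply: rst_refl. Qed.
Lemma generated_sym : symmetric generated.
Proof.
by move=> x y; apply/asboolP/asboolP => e; apply: rst_sym.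
Qed.
Lemma generated_trans : transitive generated.
Proof.
move=> y x z /asboolP xy /asboolP yz.
by apply/asboolP; apply: rst_trans yz.
Qed.

Definition generated_equiv :=
  EquivRel generated generated_refl generated_sym generated_trans.

Definition quot : Type := {eq_quot generated_equiv}.
Definition cls (x : T) : quot := \pi_{eq_quot generated_equiv} (x : {classic T}).
Definition rep (X : quot) : T := repr (X : {eq_quot generated_equiv}).

Lemma repK X : cls (rep X) = X.
Proof. exact: reprK. Qed.

Lemma clsP x y : cls x = cls y <-> clos_refl_sym_trans T R x y.
Proof.
split=> [/eqmodP/asboolP//|e].
by apply/eqmodP/asboolP.
Qed.

Lemma cls_equivP : (forall x, R x x) -> (forall x y, R x y -> R y x) ->
  (forall x y z, R x y -> R y z -> R x z) ->
  forall x y, cls x = cls y <-> R x y.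
Proof.
move=> Rr Rs Rt x y; rewrite clsP; split; last exact: rst_step.
elim=> [//|//|u v _|u v w _ uv _]; [exact: Rs | exact: Rt].
Qed.

End GeneratedQuotient.

Section Kernel.
Variables (G H : qsb) (f : star_mor G H).

Definition in_kernel : pred G := fun x => `[< exists v, f x = one v >].

Definition ker_arr : Type := {x : G | in_kernel x}.

Lemma in_kernelP (x : G) : in_kernel x <-> f x = one (mor0 f (src x)).
Proof.
split=> [/asboolP[v e]|e]; last by apply/asboolP; eexists; exact: e.
by rewrite e -mor_src e src_one.
Qed.

Lemma kerP (x : ker_arr) : f (val x) = one (mor0 f (src (val x))).
Proof. by apply/in_kernelP; exact: valP. Qed.

Lemma ker_mor0 (x : ker_arr) : mor0 f (src (val x)) = mor0 f (tgt (val x)).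
Proof. by rewrite -mor_tgt kerP tgt_one. Qed.

Lemma in_ker_one v : in_kernel (one v).
Proof. by apply/in_kernelP; rewrite mor_one src_one. Qed.
Lemma in_ker_inv (x : ker_arr) : in_kernel (val x)^-1.
Proof.
by apply/in_kernelP; rewrite mor_inv kerP inv_one src_inv -ker_mor0.
Qed.
Lemma one_mul1 (K : groupoid) (v : vert K) : one v * one v = one v.
Proof. by have := mul1x (one v); rewrite src_one. Qed.
Lemma in_ker_mul (x y : G) : in_kernel x -> in_kernel y -> tgt x = src y ->
  in_kernel (x * y).
Proof.
move=> kx ky e; apply/in_kernelP; rewrite mor_mul// src_mul//.
rewrite (in_kernelP y).1// (in_kernelP x).1// -e.
by rewrite -(ker_mor0 (Sub x kx)) one_mul1.
Qed.
Lemma in_ker_zero v : in_kernel (zero v).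
Proof. by rewrite zero_one in_ker_one. Qed.
Lemma zero_add0 (v : vert H) : zero v + zero v = zero v :> H.
Proof. by have := add0x (zero v : H); rewrite src_zero. Qed.
Lemma in_ker_opp (x : ker_arr) : in_kernel (- val x).
Proof.
apply/in_kernelP; rewrite mor_opp kerP src_opp -zero_one.
by symmetry; apply: opp_uniq => //; rewrite zero_add0 src_zero.
Qed.
Lemma in_ker_add (x y : G) : in_kernel x -> in_kernel y -> src x = src y ->
  in_kernel (x + y).
Proof.
move=> kx ky e; apply/in_kernelP; rewrite mor_add// src_add//.
rewrite (in_kernelP y).1// (in_kernelP x).1// -e.
by rewrite -zero_one zero_add0.
Qed.

Definition ker_mul (x y : ker_arr) : ker_arr := insubd x (val x * val y).
Definition ker_add (x y : ker_arr) : ker_arr := insubd x (val x + val y).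

Lemma val_ker_mul x y : tgt (val x) = src (val y) ->
  val (ker_mul x y) = val x * val y.
Proof. by move=> e; apply: insubdK; apply: in_ker_mul => //; apply: valP. Qed.
Lemma val_ker_add x y : src (val x) = src (val y) ->
  val (ker_add x y) = val x + val y.
Proof. by move=> e; apply: insubdK; apply: in_ker_add => //; apply: valP. Qed.

Definition kernel_groupoid : groupoid.
Proof.
refine (@Groupoid (vert G) ker_arr (fun x => src (val x))
  (fun x => tgt (val x)) (fun v => Sub (one v) (in_ker_one v))
  (fun x => Sub (val x)^-1 (in_ker_inv x)) ker_mul _ _ _ _ _ _ _ _ _ _ _).
- by move=> v; rewrite SubK src_one.
- by move=> v; rewrite SubK tgt_one.
- by move=> x; rewrite SubK src_inv.
- by move=> x; rewrite SubK tgt_inv.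
- by move=> x y e; rewrite val_ker_mul// src_mul.
- by move=> x y e; rewrite val_ker_mul// tgt_mul.
- move=> x y z e1 e2; apply: val_inj.
  have exy := val_ker_mul e1; have eyz := val_ker_mul e2.
  rewrite [LHS]val_ker_mul ?[RHS]val_ker_mul ?exy ?eyz ?src_mul ?tgt_mul//.
  exact: mulA.
- by move=> x; apply: val_inj; rewrite val_ker_mul SubK ?mul1x// tgt_one.
- by move=> x; apply: val_inj; rewrite val_ker_mul SubK ?mulx1// src_one.
- by move=> x; apply: val_inj; rewrite val_ker_mul !SubK ?mulVx// tgt_inv.
- by move=> x; apply: val_inj; rewrite val_ker_mul !SubK ?mulxV// src_inv.
Defined.

Definition kernel_star_groupoid : star_groupoid.
Proof.
refine (@StarGroupoid kernel_groupoid
  (fun v => Sub (zero v) (in_ker_zero v))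
  (fun x => Sub (- val x) (in_ker_opp x)) ker_add _ _ _ _ _ _ _ _) => /=.
- by move=> v; rewrite src_zero.
- by move=> x; rewrite src_opp.
- by move=> x y e; rewrite val_ker_add// src_add.
- move=> x y z e1 e2; apply: val_inj.
  have exy := val_ker_add e1; have eyz := val_ker_add e2.
  rewrite [LHS]val_ker_add ?[RHS]val_ker_add ?exy ?eyz ?src_add ?e1//.
  exact: addA.
- by move=> x; apply: val_inj; rewrite val_ker_add SubK ?add0x// src_zero.
- by move=> x; apply: val_inj; rewrite val_ker_add SubK ?addx0// src_zero.
- by move=> x; apply: val_inj; rewrite val_ker_add !SubK ?addNx// src_opp.
- by move=> x; apply: val_inj; rewrite val_ker_add !SubK ?addxN// src_opp.
Defined.

Lemma kernel_distr : skew_left_distributive kernel_star_groupoid.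
Proof.
move=> a b c e1 e2; apply: val_inj.
have {}e1 : tgt (val a) = src (val b) := e1.
have {}e2 : src (val b) = src (val c) := e2.
have e3 : tgt (val a) = src (val c) by congruence.
rewrite val_ker_mul val_ker_add ?skew_distr//; last by st_tac.
by rewrite !val_ker_add ?SubK ?val_ker_mul//; st_tac.
Qed.

Definition kernel : qsb := QSB kernel_distr.

Definition kernel_incl_groupoid : groupoid_mor kernel G :=
  @GroupoidMor kernel G id (fun x : ker_arr => val x)
    (fun=> erefl) (fun=> erefl) val_ker_mul.

Definition kernel_incl : star_mor kernel G :=
  @StarMor kernel G kernel_incl_groupoid val_ker_add.

End Kernel.

Section KernelQuotient.
Variables (G H : qsb) (f : star_mor G H).
Let N := kernel f.

Definition quot_rel (x y : G) := exists i j : N,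
  [/\ tgt (val i) = src y, tgt y = src (val j) & x = val i * y * val j].

Definition ker_connected (v w : vert G) : Prop := @connected N v w.

Definition quot_vert : Type := quot ker_connected.
Definition quot_arr : Type := quot quot_rel.
Definition vert_cls (v : vert G) : quot_vert := cls ker_connected v.
Definition arr_cls (x : G) : quot_arr := cls quot_rel x.

(* Two classes are composed, or added, after connecting representatives by some
   arrow of the kernel; by [quot_mulE], [quot_addE] and [quot_inj] the result
   depends neither on it nor on the representatives. *)
Definition connect (x : G) (v : vert G) (y : G) (op : G -> G -> G) : G :=
  if pselect (ker_connected v (src y)) is left e
  then op x (val (sval (cid e)) * y) else x.

Definition quot_src (X : quot_arr) : quot_vert := vert_cls (src (rep X)).
Definition quot_tgt (X : quot_arr) : quot_vert := vert_cls (tgt (rep X)).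
Definition quot_one (V : quot_vert) : quot_arr := arr_cls (one (rep V)).
Definition quot_inv (X : quot_arr) : quot_arr := arr_cls (rep X)^-1.
Definition quot_mul (X Y : quot_arr) : quot_arr :=
  arr_cls (connect (rep X) (tgt (rep X)) (rep Y) (@mul G)).
Definition quot_zero (V : quot_vert) : quot_arr := arr_cls (zero (rep V)).
Definition quot_opp (X : quot_arr) : quot_arr := arr_cls (- rep X).
Definition quot_add (X Y : quot_arr) : quot_arr :=
  arr_cls (connect (rep X) (src (rep X)) (rep Y) (@add G)).

Lemma quot_vertP (v w : vert G) :
  vert_cls v = vert_cls w <-> ker_connected v w.
Proof.
apply: cls_equivP; [exact: (@connected_refl N) | exact: (@connected_sym N)
  | exact: (@connected_trans N)].
Qed.

Lemma quot_relE x y :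
  quot_rel x y <-> f x = f y /\ ker_connected (src x) (src y).
Proof.
split=> [[i [j [ei ej ->]]]|[fxy [i [/= si ti]]]].
  split; last by exists i; split => //=; st_tac.
  rewrite !mor_mul; [|by st_tac..].
  rewrite (kerP i) (kerP j) -ej -mor_tgt.
  have -> : tgt (f y) = tgt (one (mor0 f (src (val i))) * f y).
    by rewrite tgt_mul// tgt_one ker_mor0 ei mor_src.
  by rewrite mulx1 ker_mor0 ei -mor_src mul1x.
have k : in_kernel f ((val i * y)^-1 * x).
  apply/in_kernelP; rewrite mor_mul ?mor_inv ?mor_mul; [|by st_tac..].
  rewrite (kerP i) ker_mor0 ti -mor_src mul1x fxy mulVx; congr one.
  by st_tac.
exists i, (Sub _ k); rewrite SubK; split=> //; first by st_tac.
by rewrite mulKVx; st_tac.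
Qed.

Lemma quot_arrP x y :
  arr_cls x = arr_cls y <-> f x = f y /\ ker_connected (src x) (src y).
Proof.
rewrite -quot_relE; apply: cls_equivP => [{}x|{}x {}y|{}x {}y z].
- by apply/quot_relE; split=> //; apply: (@connected_refl N).
- move=> /quot_relE[e c]; apply/quot_relE; split=> //.
  exact: (@connected_sym N).
- move=> /quot_relE[e c] /quot_relE[e' c']; apply/quot_relE.
  by split; [congruence | exact: (@connected_trans N _ _ _ c c')].
Qed.

Lemma ker_connected_mor0 (v w : vert G) : ker_connected v w ->
  mor0 f v = mor0 f w.
Proof. by move=> [n [<- <-]]; apply: ker_mor0. Qed.

Lemma rel_tgt x y : quot_rel x y -> ker_connected (tgt x) (tgt y).
Proof.
move=> [i [j [ei ej ->]]]; apply: (@connected_sym N).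
by exists j; split => //=; st_tac.
Qed.

Lemma rep_rel x : quot_rel (rep (arr_cls x)) x.
Proof. by apply/quot_relE/quot_arrP; exact: repK. Qed.

Lemma rep_conn v : ker_connected (rep (vert_cls v)) v.
Proof. by apply/quot_vertP; exact: repK. Qed.

Lemma quot_src_cls x : quot_src (arr_cls x) = vert_cls (src x).
Proof. by apply/quot_vertP; case/quot_relE: (rep_rel x). Qed.
Lemma quot_tgt_cls x : quot_tgt (arr_cls x) = vert_cls (tgt x).
Proof. by apply/quot_vertP; apply/rel_tgt/rep_rel. Qed.

Lemma vert_clsK V : vert_cls (rep V) = V. Proof. exact: repK. Qed.
Lemma arr_clsK X : arr_cls (rep X) = X. Proof. exact: repK. Qed.

Definition quot_mor0 (V : quot_vert) : vert H := mor0 f (rep V).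
Definition quot_mor1 (X : quot_arr) : H := f (rep X).

Lemma quot_mor0_cls v : quot_mor0 (vert_cls v) = mor0 f v.
Proof. exact/ker_connected_mor0/rep_conn. Qed.
Lemma quot_mor1_cls x : quot_mor1 (arr_cls x) = f x.
Proof. by case/quot_relE: (rep_rel x). Qed.
Lemma quot_mor1_src X : src (quot_mor1 X) = quot_mor0 (quot_src X).
Proof. by rewrite quot_mor0_cls mor_src. Qed.
Lemma quot_mor1_tgt X : tgt (quot_mor1 X) = quot_mor0 (quot_tgt X).
Proof. by rewrite quot_mor0_cls mor_tgt. Qed.

Lemma quot_inj X Y : quot_src X = quot_src Y -> quot_mor1 X = quot_mor1 Y ->
  X = Y.
Proof.
rewrite -[X]arr_clsK -[Y]arr_clsK !quot_mor1_cls !quot_src_cls => /quot_vertP c e.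
exact/quot_arrP.
Qed.

Lemma connect_mul x y : ker_connected (tgt x) (src y) ->
  [/\ src (connect x (tgt x) y (@mul G)) = src x,
      tgt (connect x (tgt x) y (@mul G)) = tgt y &
      f (connect x (tgt x) y (@mul G)) = f x * f y].
Proof.
rewrite /connect; case: pselect => // c _; case: cid => /= n [/= sn tn].
split; [by st_tac..|].
rewrite !mor_mul; [|by st_tac..].
by rewrite (kerP n) ker_mor0 tn -mor_src mul1x.
Qed.

Lemma connect_add x y : ker_connected (src x) (src y) ->
  src (connect x (src x) y (@add G)) = src x /\
  f (connect x (src x) y (@add G)) = f x + f y.
Proof.
rewrite /connect; case: pselect => // c _; case: cid => /= n [/= sn tn].
split; first by st_tac.
rewrite mor_add ?mor_mul; [|by st_tac..].
by rewrite (kerP n) ker_mor0 tn -mor_src mul1x.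
Qed.

Lemma quot_mulE X Y : quot_tgt X = quot_src Y ->
  [/\ quot_src (quot_mul X Y) = quot_src X,
      quot_tgt (quot_mul X Y) = quot_tgt Y &
      quot_mor1 (quot_mul X Y) = quot_mor1 X * quot_mor1 Y].
Proof.
move=> /quot_vertP /connect_mul [es et ef].
by rewrite quot_src_cls quot_tgt_cls quot_mor1_cls es et ef.
Qed.

Lemma quot_addE X Y : quot_src X = quot_src Y ->
  quot_src (quot_add X Y) = quot_src X /\
  quot_mor1 (quot_add X Y) = quot_mor1 X + quot_mor1 Y.
Proof.
move=> /quot_vertP /connect_add [es ef].
by rewrite quot_src_cls quot_mor1_cls es ef.
Qed.

Lemma quot_oneE V : [/\ quot_src (quot_one V) = V, quot_tgt (quot_one V) = V &
  quot_mor1 (quot_one V) = one (quot_mor0 V)].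
Proof.
by rewrite quot_src_cls quot_tgt_cls src_one tgt_one vert_clsK quot_mor1_cls mor_one.
Qed.

Lemma quot_invE X : [/\ quot_src (quot_inv X) = quot_tgt X,
  quot_tgt (quot_inv X) = quot_src X &
  quot_mor1 (quot_inv X) = (quot_mor1 X)^-1].
Proof.
by rewrite quot_src_cls quot_tgt_cls src_inv tgt_inv quot_mor1_cls mor_inv.
Qed.

Lemma quot_zeroE V : quot_src (quot_zero V) = V /\
  quot_mor1 (quot_zero V) = zero (quot_mor0 V).
Proof. by rewrite quot_src_cls src_zero vert_clsK quot_mor1_cls mor_zero. Qed.

Lemma quot_oppE X : quot_src (quot_opp X) = quot_src X /\
  quot_mor1 (quot_opp X) = - quot_mor1 X.
Proof. by rewrite quot_src_cls src_opp quot_mor1_cls mor_opp. Qed.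

Lemma quot_mul_cls x y : tgt x = src y ->
  quot_mul (arr_cls x) (arr_cls y) = arr_cls (x * y).
Proof.
move=> e; have [|es _ em] := @quot_mulE (arr_cls x) (arr_cls y).
  by rewrite quot_tgt_cls quot_src_cls e.
apply: quot_inj; first by rewrite es !quot_src_cls src_mul.
by rewrite em !quot_mor1_cls mor_mul.
Qed.

Lemma quot_add_cls x y : src x = src y ->
  quot_add (arr_cls x) (arr_cls y) = arr_cls (x + y).
Proof.
move=> e; have [|es em] := @quot_addE (arr_cls x) (arr_cls y).
  by rewrite !quot_src_cls e.
apply: quot_inj; first by rewrite es !quot_src_cls src_add.
by rewrite em !quot_mor1_cls mor_add.
Qed.

Definition quotient_groupoid : groupoid.
Proof.
refine (@Groupoid quot_vert quot_arr quot_src quot_tgt quot_one quot_inv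
  quot_mul _ _ _ _ _ _ _ _ _ _ _).
- by move=> V; case: (quot_oneE V).
- by move=> V; case: (quot_oneE V).
- by move=> X; case: (quot_invE X).
- by move=> X; case: (quot_invE X).
- by move=> X Y /quot_mulE[].
- by move=> X Y /quot_mulE[].
- move=> X Y Z e1 e2.
  have [s1 t1 m1] := quot_mulE e1; have [s2 t2 m2] := quot_mulE e2.
  have [|s3 t3 m3] := @quot_mulE X (quot_mul Y Z); first by congruence.
  have [|s4 t4 m4] := @quot_mulE (quot_mul X Y) Z; first by congruence.
  apply: quot_inj; first by congruence.
  by rewrite m3 m4 m1 m2 mulA// quot_mor1_src quot_mor1_tgt; congruence.
- move=> X; have [s1 t1 m1] := quot_oneE (quot_src X).
  have [s2 _ m2] := quot_mulE t1.
  apply: quot_inj; first by congruence.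
  by rewrite m2 m1 -quot_mor1_src mul1x.
- move=> X; have [s1 t1 m1] := quot_oneE (quot_tgt X).
  have [s2 _ m2] := quot_mulE (esym s1).
  apply: quot_inj; first by congruence.
  by rewrite m2 m1 -quot_mor1_tgt mulx1.
- move=> X; have [s1 t1 m1] := quot_invE X.
  have [s2 _ m2] := quot_mulE t1; have [s3 _ m3] := quot_oneE (quot_tgt X).
  apply: quot_inj; first by congruence.
  by rewrite m2 m1 m3 mulVx quot_mor1_tgt.
- move=> X; have [s1 t1 m1] := quot_invE X.
  have [s2 _ m2] := quot_mulE (esym s1).
  have [s3 _ m3] := quot_oneE (quot_src X).
  apply: quot_inj; first by congruence.
  by rewrite m2 m1 m3 mulxV quot_mor1_src.
Defined.

Definition quotient_star_groupoid : star_groupoid.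
Proof.
refine (@StarGroupoid quotient_groupoid quot_zero quot_opp quot_add
  _ _ _ _ _ _ _ _) => /=.
- by move=> V; case: (quot_zeroE V).
- by move=> X; case: (quot_oppE X).
- by move=> X Y /quot_addE[].
- move=> X Y Z e1 e2.
  have [s1 m1] := quot_addE e1; have [s2 m2] := quot_addE e2.
  have [|s3 m3] := @quot_addE X (quot_add Y Z); first by congruence.
  have [|s4 m4] := @quot_addE (quot_add X Y) Z; first by congruence.
  apply: quot_inj; first by congruence.
  by rewrite m3 m4 m1 m2 addA// !quot_mor1_src; congruence.
- move=> X; have [s1 m1] := quot_zeroE (quot_src X).
  have [s2 m2] := quot_addE s1.
  apply: quot_inj; first by congruence.
  by rewrite m2 m1 -quot_mor1_src add0x.
- move=> X; have [s1 m1] := quot_zeroE (quot_src X).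
  have [s2 m2] := quot_addE (esym s1).
  apply: quot_inj; first by congruence.
  by rewrite m2 m1 -quot_mor1_src addx0.
- move=> X; have [s1 m1] := quot_oppE X.
  have [s2 m2] := quot_addE s1; have [s3 m3] := quot_zeroE (quot_src X).
  apply: quot_inj; first by congruence.
  by rewrite m2 m1 m3 addNx quot_mor1_src.
- move=> X; have [s1 m1] := quot_oppE X.
  have [s2 m2] := quot_addE (esym s1).
  have [s3 m3] := quot_zeroE (quot_src X).
  apply: quot_inj; first by congruence.
  by rewrite m2 m1 m3 addxN quot_mor1_src.
Defined.

Lemma quotient_distr : skew_left_distributive quotient_star_groupoid.
Proof.
move=> X Y Z /= e1 e2.
have e3 : quot_tgt X = quot_src Z by congruence.
have [s1 m1] := quot_addE e2.
have [s2 _ m2] := quot_mulE (etrans e1 (esym s1)).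
have [s3 _ m3] := quot_mulE e1; have [s4 _ m4] := quot_mulE e3.
have [s5 m5] := quot_oppE X.
have [s6 m6] := quot_addE (etrans s3 (esym s5)).
have [|s7 m7] := @quot_addE (quot_add (quot_mul X Y) (quot_opp X))
  (quot_mul X Z); first by congruence.
apply: quot_inj; first by congruence.
rewrite m7 m6 m5 m4 m3 m2 m1 skew_distr//;
  by rewrite !quot_mor1_src ?quot_mor1_tgt; congruence.
Qed.

Definition quotient_by_kernel : qsb := QSB quotient_distr.

End KernelQuotient.

(* [1 -> ker f -> G -> H -> 1] is exact. *)
Definition induces_iso (G H : qsb) (f : star_mor G H) :=
  exists F : star_mor (quotient_by_kernel f) H,
    [/\ forall v, mor0 F (vert_cls f v) = mor0 f v,
        forall x, F (arr_cls f x) = f x & is_iso F].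

Definition is_splitting (G H : qsb) (f : star_mor G H) (s : star_mor H G) :=
  cancel (mor0 s) (mor0 f) /\ cancel s f.

(* For the right action [phi] of the additive star-groups and the left action
   [gamma] of the groupoid, [phi (- h)] inverts [phi h] and [gamma h^-1]
   inverts [gamma h]. *)
Definition twist (N H : qsb) (phi gamma : H -> N -> N)
    (h1 h2 h3 : H) (b1 b2 b3 : N) : N :=
  gamma (heap h1 h2 h3)^-1
    (heap (phi h3 (phi (- h2) (gamma h1 b1)))
          (phi h3 (phi (- h2) (gamma h2 b2)))
          (gamma h3 b3)).

(* The inclusion of the vertices of [H] into those of [N] is [emb]. Only the
   following values of the operations are meaningful: [lact h x], where [x] is
   a loop at [tgt h]; [phi h a], where [src a = src h]; [gamma h a], where
   [src a = tgt h]. That [lact h], [phi h] and [gamma h] are bijective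
   follows from the action laws. *)
Record semidirect_data (N H : qsb) (emb : vert H -> vert N) := SemidirectData {
  emb_inj : injective emb;
  emb_component : forall v : vert N, exists! m : vert H, connected v (emb m);

  lact : H -> N -> N;
  lact_loop : forall h x, loop_at (emb (tgt h)) x ->
    loop_at (emb (src h)) (lact h x);
  lactM : forall h x y, loop_at (emb (tgt h)) x -> loop_at (emb (tgt h)) y ->
    lact h (x * y) = lact h x * lact h y;
  lact_mul : forall h k x, tgt h = src k -> loop_at (emb (tgt k)) x ->
    lact (h * k) x = lact h (lact k x);
  lact_one : forall m x, loop_at (emb m) x -> lact (one m) x = x;

  phi : H -> N -> N;
  src_phi : forall h a, src a = emb (src h) -> src (phi h a) = src a;
  phiD : forall h a b, src a = emb (src h) -> src b = emb (src h) ->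
    phi h (a + b) = phi h a + phi h b;
  phi_add : forall h k a, src h = src k -> src a = emb (src h) ->
    phi (h + k) a = phi k (phi h a);
  phi_zero : forall m a, src a = emb m -> phi (zero m) a = a;

  gamma : H -> N -> N;
  src_gamma : forall h a, src a = emb (tgt h) ->
    src (gamma h a) = emb (src h);
  gammaD : forall h a b, src a = emb (tgt h) -> src b = emb (tgt h) ->
    gamma h (a + b) = gamma h a + gamma h b;
  gamma_mul : forall h k a, tgt h = src k -> src a = emb (tgt k) ->
    gamma (h * k) a = gamma h (gamma k a);
  gamma_one : forall m a, src a = emb m -> gamma (one m) a = a;

  twist_loop : forall h1 h2 h3 b1 b2 b3 l,
    src h1 = src h2 -> src h2 = src h3 ->
    src b1 = emb (tgt h1) -> src b2 = emb (tgt h2) -> src b3 = emb (tgt h3) ->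
    loop_at (emb (src h1)) l ->
    twist phi gamma h1 h2 h3
      (lact h1^-1 l * b1) (lact h2^-1 l * b2) (lact h3^-1 l * b3) =
    lact (heap h1 h2 h3)^-1 l * twist phi gamma h1 h2 h3 b1 b2 b3 }.

Definition ract (N H : qsb) (emb : vert H -> vert N)
  (D : semidirect_data emb) (x : N) (h : H) : N := lact D h^-1 x.

Section Semidirect.
Variables (N H : qsb) (emb : vert H -> vert N) (D : semidirect_data emb).
Implicit Types (a b c d l : N) (h k : H) (m : vert H).

Local Notation T := (twist (phi D) (gamma D)).

Definition composable (t : N * H * N) :=
  let: (a, h, b) := t in tgt a = emb (src h) /\ emb (tgt h) = src b.

Definition triple : Type := {t : N * H * N | `[< composable t >]}.
Definition mk_triple (t : N * H * N) (c : composable t) : triple :=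
  exist _ t (asboolT c).

Inductive tensor_step : N * H * N -> N * H * N -> Prop :=
| tensor_step_left a b h c d :
    tgt a = emb (src h) -> loop_at (emb (src h)) b ->
    loop_at (emb (tgt h)) c -> emb (tgt h) = src d ->
    tensor_step (a * b, h, c * d) (a * b * lact D h c, h, d)
| tensor_step_right a b h c d :
    tgt a = emb (src h) -> loop_at (emb (src h)) b ->
    loop_at (emb (tgt h)) c -> emb (tgt h) = src d ->
    tensor_step (a * b * lact D h c, h, d) (a, h, ract D b h * c * d).

Definition tensor : Type := quot (fun t u : triple => tensor_step (val t) (val u)).

Definition tensor_cls (t : triple) : tensor :=
  cls (fun t u : triple => tensor_step (val t) (val u)) t.

(* The operations on classes are computed on representatives; by
   [represents_mul], [represents_inv], [represents_one] and [represents_heap]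
   they do not depend on the choice. *)
Definition fst_arr (X : tensor) : N := (val (rep X)).1.1.
Definition mid_arr (X : tensor) : H := (val (rep X)).1.2.
Definition lst_arr (X : tensor) : N := (val (rep X)).2.

Definition sd_src (X : tensor) : vert N := src (fst_arr X).
Definition sd_tgt (X : tensor) : vert N := tgt (lst_arr X).

Definition sd_mul (X Y : tensor) : tensor :=
  tensor_cls (insubd (rep X)
    (fst_arr X * lact D (mid_arr X) (lst_arr X * fst_arr Y),
     mid_arr X * mid_arr Y, lst_arr Y)).

Definition sd_heap (X Y Z : tensor) : tensor :=
  tensor_cls (insubd (rep X)
    (fst_arr X, heap (mid_arr X) (mid_arr Y) (mid_arr Z),
     T (mid_arr X) (mid_arr Y) (mid_arr Z) (lst_arr X)
       (ract D ((fst_arr X)^-1 * fst_arr Y) (mid_arr Y) * lst_arr Y)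
       (ract D ((fst_arr X)^-1 * fst_arr Z) (mid_arr Z) * lst_arr Z))).

Lemma inv_composable (X : tensor) :
  composable ((lst_arr X)^-1, (mid_arr X)^-1, (fst_arr X)^-1).
Proof.
have /asboolP := valP (rep X).
rewrite /composable /lst_arr /mid_arr /fst_arr.
by case: (val (rep X)) => [[a h] b] /= [? ?]; split; st_tac.
Qed.

Definition sd_inv (X : tensor) : tensor := tensor_cls (mk_triple (inv_composable X)).

Lemma base_arrow (v : vert N) :
  exists p : vert H * N, src p.2 = v /\ tgt p.2 = emb p.1.
Proof. by have [m [[a ?] _]] := emb_component D v; exists (m, a). Qed.

Definition base (v : vert N) : vert H * N := sval (cid (base_arrow v)).

Lemma unit_composable (v : vert N) :
  composable ((base v).2, one (base v).1, (base v).2^-1).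
Proof. by rewrite /base; case: cid => [[m a] /= [? ?]]; split; st_tac.
Qed.

Definition sd_one (v : vert N) : tensor :=
  tensor_cls (mk_triple (unit_composable v)).

Definition sd_add (X Y : tensor) : tensor := sd_heap X (sd_one (sd_src X)) Y.
Definition sd_opp (X : tensor) : tensor :=
  sd_heap (sd_one (sd_src X)) X (sd_one (sd_src X)).

Definition represents a h b (X : tensor) :=
  exists t : triple, val t = (a, h, b) /\ X = tensor_cls t.


Lemma emb_connected m m' : @connected N (emb m) (emb m') -> m = m'.
Proof.
move=> c; have [m0 [_ u]] := emb_component D (emb m).
by rewrite -(u m (connected_refl _)) (u m' c).
Qed.

Lemma loop_mul (v : vert N) (x y : N) :
  loop_at v x -> loop_at v y -> loop_at v (x * y).
Proof. by move=> [? ?] [? ?]; split; st_tac. Qed.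
Lemma loop_inv (v : vert N) (x : N) : loop_at v x -> loop_at v x^-1.
Proof. by move=> [? ?]; split; st_tac. Qed.
Lemma loop_one (v : vert N) : loop_at v (one v : N).
Proof. by split; st_tac. Qed.

Lemma ract_loop h l : loop_at (emb (src h)) l ->
  loop_at (emb (tgt h)) (ract D l h).
Proof.
by move=> ll; rewrite -[tgt h]src_inv; apply: lact_loop; rewrite tgt_inv.
Qed.

Lemma lact_ract h l : loop_at (emb (src h)) l -> lact D h (ract D l h) = l.
Proof.
move=> ll; rewrite /ract -lact_mul ?tgt_inv ?src_inv// mulxV.
exact: lact_one.
Qed.

Lemma ract_lact h l : loop_at (emb (tgt h)) l -> ract D (lact D h l) h = l.
Proof.
move=> ll; rewrite /ract -lact_mul ?tgt_inv ?src_inv// mulVx.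
exact: lact_one.
Qed.

Lemma ractM h x y : loop_at (emb (src h)) x -> loop_at (emb (src h)) y ->
  ract D (x * y) h = ract D x h * ract D y h.
Proof. by move=> lx ly; rewrite /ract lactM// tgt_inv. Qed.

Lemma ract_mul h k l : tgt h = src k -> loop_at (emb (src h)) l ->
  ract D l (h * k) = ract D (ract D l h) k.
Proof.
by move=> e ll; rewrite /ract invM// lact_mul ?tgt_inv ?src_inv.
Qed.

Lemma lact_loop1 h : lact D h (one (emb (tgt h))) = one (emb (src h)).
Proof.
have l1 := loop_one (emb (tgt h)); have [sl tl] := lact_loop D l1.
rewrite -[in RHS]sl; apply: idem_one; first by rewrite sl tl.
by rewrite -lactM// one_mul1.
Qed.

Lemma ract_loop1 h : ract D (one (emb (src h))) h = one (emb (tgt h)).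
Proof. by rewrite /ract -(tgt_inv h) lact_loop1 src_inv. Qed.

Definition tensor_rel (t u : N * H * N) :=
  t.1.2 = u.1.2 /\ exists l, [/\ loop_at (emb (src t.1.2)) l,
    u.1.1 = t.1.1 * l & t.2 = ract D l t.1.2 * u.2].

Lemma tensor_rel_refl t : composable t -> tensor_rel t t.
Proof.
case: t => [[a h] b] [ea eb]; split=> //=; exists (one (emb (src h))).
split; [exact: loop_one | by rewrite -ea mulx1 |].
by rewrite ract_loop1 eb mul1x.
Qed.

Lemma tensor_rel_sym t u : composable t -> composable u ->
  tensor_rel t u -> tensor_rel u t.
Proof.
case: t => [[a h] b]; case: u => [[a' h'] b'] /= [ea eb] [ea' eb'].
move=> [/= e]; subst h'; move=> [l [ll -> ->]]; split=> //=.
exists l^-1; split; first exact: loop_inv.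
  by case: ll => ? ?; rewrite mulxK; st_tac.
have lv := loop_inv ll.
have [? ?] := ract_loop ll; have [? ?] := ract_loop lv.
rewrite mulA; [|by st_tac..].
rewrite -ractM//; case: (ll) => sl tl.
by rewrite mulVx tl ract_loop1 eb' mul1x.
Qed.

Lemma tensor_rel_trans t u v : composable t -> composable u -> composable v ->
  tensor_rel t u -> tensor_rel u v -> tensor_rel t v.
Proof.
case: t => [[a h] b]; case: u => [[a' h'] b']; case: v => [[a2 h2] b2] /=.
move=> [ea eb] [ea' eb'] [ea2 eb2] [/= e]; subst h'.
move=> [l [ll -> ->]] [/= e]; subst h2.
move=> [m [lm -> ->]]; split=> //=.
exists (l * m); split; first exact: loop_mul.
  by case: ll => ? ?; case: lm => ? ?; rewrite mulA; st_tac.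
have [? ?] := ract_loop ll; have [? ?] := ract_loop lm.
by rewrite ractM// mulA; st_tac.
Qed.

Lemma tensor_step_rel t u : tensor_step t u -> tensor_rel t u \/ tensor_rel u t.
Proof.
case=> {t u} a b h c d ea lb lc ed; [left|right]; split=> //=.
  exists (lact D h c); split=> //; first exact: lact_loop.
  by rewrite ract_lact.
have lhc := lact_loop D lc.
exists (b * lact D h c); split; first exact: loop_mul.
  by case: lb => ? ?; case: lhc => ? ?; rewrite mulA; st_tac.
by rewrite ractM// ract_lact.
Qed.

Lemma tripleP (t : triple) : composable (val t).
Proof. by have /asboolP := valP t. Qed.

Lemma tensor_step_cls x y (cx : composable x) (cy : composable y) :
  tensor_step x y -> tensor_cls (mk_triple cx) = tensor_cls (mk_triple cy).
Proof. by move=> st; apply: (clsP _ _ _).2; apply: rst_step. Qed.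

Lemma tensor_clsP t u : tensor_cls t = tensor_cls u <->
  tensor_rel (val t) (val u).
Proof.
split.
  move=> /clsP; elim=> [v w /tensor_step_rel[//|]|v|v w _|v w x _ vw _].
  - by apply: tensor_rel_sym; apply: tripleP.
  - by apply: tensor_rel_refl; apply: tripleP.
  - by apply: tensor_rel_sym; apply: tripleP.
  - by apply: tensor_rel_trans vw; apply: tripleP.
have := tripleP t; have := tripleP u; rewrite /tensor_rel.
case E : (val t) => [[a h] b]; case E' : (val u) => [[a' h'] b'] /=.
move=> [ea' eb'] [ea eb] [e]; subst h'; move=> [l [ll ea1 eb1]].
have [sl tl] := ll; have [sr tr] := ract_loop ll.
have lo := loop_one (emb (tgt h)).
have e1 : a * l * lact D h (one (emb (tgt h))) = a'.
  rewrite lact_loop1 ea1; have -> : emb (src h) = tgt (a * l) by st_tac.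
  exact: mulx1.
have e2 : ract D l h * one (emb (tgt h)) * b' = b.
  by rewrite -tr mulx1 eb1.
have ct : composable (a, h, b) by [].
have cu : composable (a', h, b') by [].
have -> : t = mk_triple ct by apply: val_inj; rewrite E.
have -> : u = mk_triple cu by apply: val_inj; rewrite E'.
symmetry; apply: tensor_step_cls; rewrite -{1}e1 -e2.
exact: tensor_step_right.
Qed.

Lemma represents_comp a h b X : represents a h b X ->
  tgt a = emb (src h) /\ emb (tgt h) = src b.
Proof. by move=> [t [e _]]; have := tripleP t; rewrite e. Qed.

Lemma represents_rel a h b a' h' b' X :
  represents a h b X -> represents a' h' b' X ->
  h = h' /\ exists l, [/\ loop_at (emb (src h)) l, a' = a * l
    & b = ract D l h * b'].
Proof.
move=> [t [e ->]] [u [e' /tensor_clsP]].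
by rewrite e e'.
Qed.

Lemma represents_ex a h b : tgt a = emb (src h) -> emb (tgt h) = src b ->
  exists X, represents a h b X.
Proof.
move=> ea eb; have c : composable (a, h, b) by [].
by exists (tensor_cls (mk_triple c)), (mk_triple c).
Qed.

Lemma represents_inj a h b X Y :
  represents a h b X -> represents a h b Y -> X = Y.
Proof.
move=> [t [e ->]] [u [e' ->]]; apply/tensor_clsP.
by rewrite e' -e; apply/tensor_rel_refl/tripleP.
Qed.

Lemma represents_rep X : represents (fst_arr X) (mid_arr X) (lst_arr X) X.
Proof.
exists (rep X); rewrite /tensor_cls repK; split=> //.
by rewrite /fst_arr /mid_arr /lst_arr; case: (val _) => [[]].
Qed.

Lemma represents_slide a h b l X :
  loop_at (emb (src h)) l -> tgt a = emb (src h) -> emb (tgt h) = src b ->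
  represents (a * l) h b X <-> represents a h (ract D l h * b) X.
Proof.
move=> ll ea eb; have [sl tl] := ll; have [sr tr] := ract_loop ll.
have c1 : composable (a * l, h, b) by split=> //; st_tac.
have c2 : composable (a, h, ract D l h * b) by split=> //; st_tac.
have e : tensor_cls (mk_triple c1) = tensor_cls (mk_triple c2).
  by symmetry; apply/tensor_clsP; split=> //; exists l.
split=> [r|r].
  exists (mk_triple c2); split=> //; rewrite -e.
  by apply: (represents_inj r); exists (mk_triple c1).
exists (mk_triple c1); split=> //; rewrite e.
by apply: (represents_inj r); exists (mk_triple c2).
Qed.

Lemma represents_move a a' h b X : represents a h b X ->
  src a' = src a -> tgt a' = emb (src h) ->
  represents a' h (ract D (a'^-1 * a) h * b) X.
Proof.
move=> r es et; have [ea eb] := represents_comp r.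
apply/represents_slide => //; first by split; st_tac.
by rewrite mulKVx.
Qed.

Lemma represents_src a h b X : represents a h b X -> sd_src X = src a.
Proof.
move=> r; have [ea _] := represents_comp (represents_rep X).
by have [_ [l [[? ?] -> _]]] := represents_rel (represents_rep X) r;
  rewrite /sd_src; st_tac.
Qed.

Lemma represents_tgt a h b X : represents a h b X -> sd_tgt X = tgt b.
Proof.
move=> r; have [_ eb] := represents_comp r.
have [e [l [ll _ el]]] := represents_rel (represents_rep X) r.
have [sr tr] := ract_loop ll.
by rewrite /sd_tgt el tgt_mul// tr e.
Qed.

Lemma sd_tgt_src a1 h1 b1 a2 h2 b2 X Y :
  represents a1 h1 b1 X -> represents a2 h2 b2 Y ->
  sd_tgt X = sd_src Y -> tgt b1 = src a2 /\ tgt h1 = src h2.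
Proof.
move=> r1 r2; rewrite (represents_tgt r1) (represents_src r2) => e.
have [ea1 eb1] := represents_comp r1; have [ea2 eb2] := represents_comp r2.
by split=> //; apply: emb_connected; exists (b1 * a2); split; st_tac.
Qed.

Lemma represents_mul a1 h1 b1 a2 h2 b2 X Y :
  represents a1 h1 b1 X -> represents a2 h2 b2 Y -> sd_tgt X = sd_src Y ->
  represents (a1 * lact D h1 (b1 * a2)) (h1 * h2) b2 (sd_mul X Y).
Proof.
move=> r1 r2 e; have [e1 e2] := sd_tgt_src r1 r2 e.
have [ea1 eb1] := represents_comp r1; have [ea2 eb2] := represents_comp r2.
have rX := represents_rep X; have rY := represents_rep Y.
have [eA1 eB1] := represents_comp rX; have [eA2 eB2] := represents_comp rY.
have [E1 E2] := sd_tgt_src rX rY e.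
have [eh1 [l [ll el el']]] := represents_rel rX r1.
have [eh2 [m [lm em em']]] := represents_rel rY r2.
move: eA1 eB1 eA2 eB2 E1 E2 ll el el' lm em em'; rewrite /sd_mul eh1 eh2.
set A1 := fst_arr X; set B1 := lst_arr X; set A2 := fst_arr Y.
set B2 := lst_arr Y.
move=> eA1 eB1 eA2 eB2 E1 E2 ll el el' lm em em'.
have [sl tl] := ll; have [sm tm] := lm.
have lr := ract_loop ll; have [sr tr] := lr.
have e5 : tgt b1 = src A2 by rewrite e1 em; st_tac.
have l1 : loop_at (emb (tgt h1)) (B1 * A2) by split; st_tac.
have l2 : loop_at (emb (tgt h1)) (b1 * A2) by split; st_tac.
have lm1 : loop_at (emb (tgt h1)) m by split; st_tac.
have [s1 t1] := lact_loop D l1; have [s2 t2] := lact_loop D l2.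
have [s3 t3] := lact_loop D lm1.
have c : composable (A1 * lact D h1 (B1 * A2), h1 * h2, B2).
  by split; st_tac.
have : represents (A1 * lact D h1 (B1 * A2)) (h1 * h2) B2 (tensor_cls
  (insubd (rep X) (A1 * lact D h1 (B1 * A2), h1 * h2, B2))).
  by eexists; split; last by []; rewrite insubdK//; apply/asboolP.
have -> : A1 * lact D h1 (B1 * A2) = a1 * lact D h1 (b1 * A2).
  rewrite el' -mulA//; last by st_tac.
  by rewrite lactM// lact_ract// el mulA//; st_tac.
have -> : B2 = ract D (lact D h1 m) (h1 * h2) * b2.
  by rewrite ract_mul// ?ract_lact// src_mul//; apply: lact_loop.
move=> r; rewrite em.
have -> : a1 * lact D h1 (b1 * (A2 * m)) =
    a1 * lact D h1 (b1 * A2) * lact D h1 m.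
  rewrite -mulA; [|by st_tac..].
  by rewrite -lactM// mulA//; st_tac.
have l3 : loop_at (emb (src (h1 * h2))) (lact D h1 m).
  by rewrite src_mul//; apply: lact_loop.
have e3 : tgt (a1 * lact D h1 (b1 * A2)) = emb (src (h1 * h2)) by st_tac.
have e4 : emb (tgt (h1 * h2)) = src b2 by st_tac.
exact: (proj2 (represents_slide _ l3 e3 e4)).
Qed.

Lemma ractV h l : loop_at (emb (src h)) l ->
  (ract D l h)^-1 = ract D l^-1 h.
Proof.
move=> ll; have lv := loop_inv ll; have [sl tl] := ll.
have [sr tr] := ract_loop ll; have [sv tv] := ract_loop lv.
symmetry; apply: inv_uniq; first by st_tac.
by rewrite -ractM// mulxV sl ract_loop1 sr.
Qed.

Lemma represents_inv a h b X : represents a h b X ->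
  represents b^-1 h^-1 a^-1 (sd_inv X).
Proof.
move=> r; have [ea eb] := represents_comp r.
have rX := represents_rep X; have [eA eB] := represents_comp rX.
have [eh [l [ll el el']]] := represents_rel rX r.
have : represents (lst_arr X)^-1 (mid_arr X)^-1 (fst_arr X)^-1 (sd_inv X).
  by exists (mk_triple (inv_composable X)).
rewrite eh in ll eA eB el' *.
have [sl tl] := ll; have lr := ract_loop ll; have [sr tr] := lr.
have lv := loop_inv ll.
rewrite el' el !invM; [|by st_tac..].
move/represents_slide; rewrite src_inv tgt_inv => /(_ (loop_inv lr)).
have -> : ract D (ract D l h)^-1 h^-1 = l^-1.
  by rewrite ractV// /ract invK; apply: lact_ract.
by apply; st_tac.
Qed.

Lemma represents_one m a : tgt a = emb m ->
  represents a (one m) a^-1 (sd_one (src a)).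
Proof.
move=> ea; rewrite /sd_one; move: (unit_composable (src a)).
rewrite /base; case: cid => [[m' a'] /= [es et]] c.
have em : m' = m.
  by apply: emb_connected; exists (a'^-1 * a); split; st_tac.
subst m'.
set t := @mk_triple (a', one m, a'^-1) c.
have r : represents a' (one m) a'^-1 (tensor_cls t) by exists t.
have := @represents_move a' a _ _ _ r; rewrite src_one => /(_ (esym es) ea).
by rewrite /ract inv_one lact_one ?mulxK//; [st_tac|split; st_tac].
Qed.

Lemma phiN h a : src a = emb (src h) -> phi D h (- a) = - phi D h a.
Proof.
move=> e; have e' : src (- a) = emb (src h) by st_tac.
apply: opp_uniq; first by rewrite !src_phi; st_tac.
rewrite -phiD// addxN.
rewrite [LHS]addid0; first by rewrite !src_phi ?src_zero.
by rewrite -phiD ?src_zero// zero_add0.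
Qed.

Lemma gammaN h a : src a = emb (tgt h) -> gamma D h (- a) = - gamma D h a.
Proof.
move=> e; have e' : src (- a) = emb (tgt h) by st_tac.
apply: opp_uniq; first by rewrite !src_gamma; st_tac.
rewrite -gammaD// addxN.
rewrite [LHS]addid0; first by rewrite !src_gamma ?src_zero.
by rewrite -gammaD ?src_zero// zero_add0.
Qed.

Lemma phi_heap h a b c :
  src a = emb (src h) -> src b = emb (src h) -> src c = emb (src h) ->
  phi D h (heap a b c) = heap (phi D h a) (phi D h b) (phi D h c).
Proof. by rewrite /heap => *; rewrite !phiD ?phiN//; st_tac. Qed.

Lemma gamma_heap h a b c :
  src a = emb (tgt h) -> src b = emb (tgt h) -> src c = emb (tgt h) ->
  gamma D h (heap a b c) = heap (gamma D h a) (gamma D h b) (gamma D h c).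
Proof. by rewrite /heap => *; rewrite !gammaD ?gammaN//; st_tac. Qed.

Lemma phi_heap_index h1 h2 h3 a : src h1 = src h2 -> src h2 = src h3 ->
  src a = emb (src h1) ->
  phi D (heap h1 h2 h3) a = phi D h3 (phi D (- h2) (phi D h1 a)).
Proof. by rewrite /heap => *; rewrite !phi_add//; st_tac. Qed.

Lemma phiNK h a : src a = emb (src h) -> phi D h (phi D (- h) a) = a.
Proof.
by move=> e; rewrite -phi_add ?src_opp// addNx phi_zero.
Qed.

Lemma phiKN h a : src a = emb (src h) -> phi D (- h) (phi D h a) = a.
Proof.
by move=> e; rewrite -phi_add ?src_opp// addxN phi_zero.
Qed.

Lemma gammaVK h a : src a = emb (src h) -> gamma D h (gamma D h^-1 a) = a.
Proof.
by move=> e; rewrite -gamma_mul ?src_inv ?tgt_inv// mulxV gamma_one.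
Qed.

Lemma gammaKV h a : src a = emb (tgt h) -> gamma D h^-1 (gamma D h a) = a.
Proof.
by move=> e; rewrite -gamma_mul ?src_inv ?tgt_inv// mulVx gamma_one.
Qed.

Definition twisted (m : vert H) h b := src h = m /\ src b = emb (tgt h).

Lemma src_shift (m : vert H) h2 h3 c :
  src h2 = m -> src h3 = m -> src c = emb m ->
  src (phi D h3 (phi D (- h2) c)) = emb m.
Proof. by move=> e2 e3 e; rewrite !src_phi ?src_opp ?e2 ?e3. Qed.

Lemma src_gammam (m : vert H) h b : twisted m h b ->
  src (gamma D h b) = emb m.
Proof. by move=> [/= e eb]; rewrite src_gamma ?e. Qed.

Section Twist.
Variable m : vert H.

Lemma src_twist_arg h1 h2 h3 b1 b2 b3 :
  twisted m h1 b1 -> twisted m h2 b2 -> twisted m h3 b3 ->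
  src (heap h1 h2 h3) = m /\
  src (heap (phi D h3 (phi D (- h2) (gamma D h1 b1)))
            (phi D h3 (phi D (- h2) (gamma D h2 b2)))
            (gamma D h3 b3)) = emb m.
Proof.
move=> t1 t2 t3.
have [g1 g2 g3] := And3 (src_gammam t1) (src_gammam t2) (src_gammam t3).
case: t1 t2 t3 => /= [s1 _] [s2 _] [s3 _].
by split; rewrite src_heap ?(@src_shift m)// ?s1 ?s2 ?s3.
Qed.

Lemma src_twist h1 h2 h3 b1 b2 b3 :
  twisted m h1 b1 -> twisted m h2 b2 -> twisted m h3 b3 ->
  twisted m (heap h1 h2 h3) (T h1 h2 h3 b1 b2 b3).
Proof.
move=> t1 t2 t3; have [s1 s2] := src_twist_arg t1 t2 t3.
by split=> //=; rewrite /twist src_gamma ?src_inv// tgt_inv s1.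
Qed.

Lemma gamma_twist h1 h2 h3 b1 b2 b3 :
  twisted m h1 b1 -> twisted m h2 b2 -> twisted m h3 b3 ->
  gamma D (heap h1 h2 h3) (T h1 h2 h3 b1 b2 b3) =
  heap (phi D h3 (phi D (- h2) (gamma D h1 b1)))
       (phi D h3 (phi D (- h2) (gamma D h2 b2))) (gamma D h3 b3).
Proof.
move=> t1 t2 t3; have [s1 s2] := src_twist_arg t1 t2 t3.
by rewrite /twist gammaVK// s1.
Qed.

Lemma twistA h1 h2 h3 h4 h5 b1 b2 b3 b4 b5 :
  twisted m h1 b1 -> twisted m h2 b2 -> twisted m h3 b3 ->
  twisted m h4 b4 -> twisted m h5 b5 ->
  T (heap h1 h2 h3) h4 h5 (T h1 h2 h3 b1 b2 b3) b4 b5 =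
  T h1 h2 (heap h3 h4 h5) b1 b2 (T h3 h4 h5 b3 b4 b5).
Proof.
move=> t1 t2 t3 t4 t5.
rewrite {1}/twist gamma_twist// [RHS]/twist gamma_twist//.
have [g1 g2 g3 g4] :=
  And4 (src_gammam t1) (src_gammam t2) (src_gammam t3) (src_gammam t4).
have g5 := src_gammam t5.
case: t1 t2 t3 t4 t5 => /= [s1 _] [s2 _] [s3 _] [s4 _] [s5 _].
have -> : heap (heap h1 h2 h3) h4 h5 = heap h1 h2 (heap h3 h4 h5).
  by apply: heapA; congruence.
congr gamma.
have P c : src c = emb m ->
    phi D (heap h3 h4 h5) c = phi D h5 (phi D (- h4) (phi D h3 c)).
  by move=> ec; apply: phi_heap_index; congruence.
have S2 c : src c = emb m -> src (phi D (- h2) c) = emb m.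
  by move=> ec; rewrite src_phi// src_opp s2.
have S4 c : src c = emb m -> src (phi D (- h4) c) = emb m.
  by move=> ec; rewrite src_phi// src_opp s4.
have S3 c : src c = emb m -> src (phi D h3 c) = emb m.
  by move=> ec; rewrite src_phi// s3.
have S5 c : src c = emb m -> src (phi D h5 c) = emb m.
  by move=> ec; rewrite src_phi// s5.
rewrite !P ?S2// -heapA; last 4 first.
- by rewrite !S5 ?S4 ?S3 ?S2.
- by rewrite !S5 ?S4 ?S3 ?S2.
- by rewrite !S5 ?S4.
- by rewrite g5 S5 ?S4.
congr heap.
by rewrite phi_heap ?phi_heap// ?src_opp ?s4 ?s5 ?S4 ?S3 ?S2.
Qed.

Lemma twistxyy h1 h2 b1 b2 : twisted m h1 b1 -> twisted m h2 b2 ->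
  T h1 h2 h2 b1 b2 b2 = b1.
Proof.
move=> t1 t2; have g1 := src_gammam t1; have g2 := src_gammam t2.
case: t1 t2 => /= [s1 e1] [s2 e2].
by rewrite /twist !phiNK ?g1 ?g2 ?s2// !heapxyy ?gammaKV ?g1 ?g2; congruence.
Qed.

Lemma twistxxy h1 h2 b1 b2 : twisted m h1 b1 -> twisted m h2 b2 ->
  T h1 h1 h2 b1 b1 b2 = b2.
Proof.
move=> t1 t2; have g1 := src_gammam t1; have g2 := src_gammam t2.
have sh := @src_shift m.
case: t1 t2 => /= [s1 e1] [s2 e2].
by rewrite /twist !heapxxy ?gammaKV ?sh ?g2; congruence.
Qed.

End Twist.

Lemma represents_twisted a h b X : represents a h b X -> twisted (src h) h b.
Proof. by case/represents_comp => _ e; split. Qed.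

Lemma sd_src_emb a1 h1 b1 a2 h2 b2 X Y :
  represents a1 h1 b1 X -> represents a2 h2 b2 Y ->
  sd_src X = sd_src Y -> src a1 = src a2 /\ src h1 = src h2.
Proof.
move=> r1 r2; rewrite (represents_src r1) (represents_src r2) => e.
have [ea1 _] := represents_comp r1; have [ea2 _] := represents_comp r2.
by split=> //; apply: emb_connected; exists (a1^-1 * a2); split; st_tac.
Qed.

Lemma shift_reps a1 h1 b1 a2 h2 b2 A1 B1 A2 B2 X Y :
  represents a1 h1 b1 X -> represents a2 h2 b2 Y ->
  represents A1 h1 B1 X -> represents A2 h2 B2 Y ->
  sd_src X = sd_src Y ->
  forall l, loop_at (emb (src h1)) l -> a1 = A1 * l ->
  ract D (a1^-1 * a2) h2 * b2 =
  ract D l^-1 h2 * (ract D (A1^-1 * A2) h2 * B2).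
Proof.
move=> r1 r2 R1 R2 e l ll el; rewrite el.
have [ea eh] := sd_src_emb R1 R2 e.
have [eA1 eB1] := represents_comp R1; have [eA2 eB2] := represents_comp R2.
have [ea2 eb2] := represents_comp r2.
have [_ [l2 [ll2 -> ->]]] := represents_rel R2 r2.
have lv := loop_inv ll; have [sl tl] := ll; have [sl2 tl2] := ll2.
rewrite eh in lv sl tl.
have lA : loop_at (emb (src h2)) (A1^-1 * A2) by split; st_tac.
have lA2 : loop_at (emb (src h2)) (A1^-1 * A2 * l2) by split; st_tac.
have [s1 t1] := ract_loop lv; have [s2 t2] := ract_loop lA.
have [s3 t3] := ract_loop ll2.
have -> : (A1 * l)^-1 * (A2 * l2) = l^-1 * (A1^-1 * A2 * l2).
  by rewrite invM ?mulA//; st_tac.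
have l23 : loop_at (emb (src h2)) (l^-1 * (A1^-1 * A2 * l2)).
  by apply: loop_mul.
rewrite ractM// ractM//.
rewrite -mulA; [|by st_tac..].
by congr mul; rewrite -mulA//; st_tac.
Qed.

Lemma represents_heap a1 h1 b1 a2 h2 b2 a3 h3 b3 X Y Z :
  represents a1 h1 b1 X -> represents a2 h2 b2 Y -> represents a3 h3 b3 Z ->
  sd_src X = sd_src Y -> sd_src X = sd_src Z ->
  represents a1 (heap h1 h2 h3)
    (T h1 h2 h3 b1 (ract D (a1^-1 * a2) h2 * b2) (ract D (a1^-1 * a3) h3 * b3))
    (sd_heap X Y Z).
Proof.
move=> r1 r2 r3 e12 e13.
have R1 := represents_rep X; have R2 := represents_rep Y.
have R3 := represents_rep Z.
have [E1 [l [ll el elb]]] := represents_rel R1 r1.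
have [E2 _] := represents_rel R2 r2; have [E3 _] := represents_rel R3 r3.
rewrite /sd_heap; move: R1 R2 R3 ll elb.
rewrite {}E1 {}E2 {}E3 => R1 R2 R3 ll elb.
rewrite (shift_reps r1 r2 R1 R2 e12 ll el).
rewrite (shift_reps r1 r3 R1 R3 e13 ll el).
have [ea12 eh12] := sd_src_emb R1 R2 e12.
have [ea13 eh13] := sd_src_emb R1 R3 e13.
set Y2 := ract D (_^-1 * _) h2 * _; set Y3 := ract D (_^-1 * _) h3 * _.
have [eA1 eB1] := represents_comp R1; have [eA2 eB2] := represents_comp R2.
have [eA3 eB3] := represents_comp R3; have [ea1 eb1] := represents_comp r1.
have lA2 : loop_at (emb (src h2)) ((fst_arr X)^-1 * fst_arr Y).
  by split; st_tac.
have lA3 : loop_at (emb (src h3)) ((fst_arr X)^-1 * fst_arr Z).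
  by split; st_tac.
have [sl tl] := ll; have [s2 t2] := ract_loop lA2.
have [s3 t3] := ract_loop lA3.
have eY2 : src Y2 = emb (tgt h2) by rewrite /Y2; st_tac.
have eY3 : src Y3 = emb (tgt h3) by rewrite /Y3; st_tac.
have lv := loop_inv ll; have [slr tlr] := ract_loop ll.
have -> : b1 = ract D l^-1 h1 * lst_arr X.
  by rewrite elb -ractV// mulKx; st_tac.
have tw : twisted (src h1) (heap h1 h2 h3)
    (T h1 h2 h3 (lst_arr X) Y2 Y3).
  by apply: src_twist.
case: (tw) => sh sT.
have := @twist_loop _ _ _ D h1 h2 h3 (lst_arr X) Y2 Y3 l^-1.
rewrite -/(ract D _ _) -eh12 -eh13 => /(_ erefl erefl (esym eB1) eY2 eY3 lv).
rewrite -!/(ract D _ _) => ->.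
have c : composable (fst_arr X, heap h1 h2 h3, T h1 h2 h3 (lst_arr X) Y2 Y3).
  by split; rewrite ?sh ?sT.
apply/represents_slide; rewrite ?sh ?sT//.
rewrite el mulxK; last by st_tac.
by eexists; split; last by []; rewrite insubdK//; apply/asboolP.
Qed.

Lemma represents_src_eq a h b X Y : represents a h b X ->
  sd_src X = sd_src Y ->
  exists k d, src k = src h /\ represents a k d Y.
Proof.
move=> r e; have r' := represents_rep Y; have [ea ek] := sd_src_emb r r' e.
have [ta _] := represents_comp r.
have := represents_move r' ea; rewrite -ek => /(_ ta) rY.
by eexists; eexists; split; last exact: rY.
Qed.

Lemma represents_heap_common a h1 b1 h2 b2 h3 b3 X Y Z :
  represents a h1 b1 X -> represents a h2 b2 Y -> represents a h3 b3 Z ->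
  represents a (heap h1 h2 h3) (T h1 h2 h3 b1 b2 b3) (sd_heap X Y Z).
Proof.
move=> r1 r2 r3.
have e2 : sd_src X = sd_src Y by rewrite (represents_src r1) (represents_src r2).
have e3 : sd_src X = sd_src Z by rewrite (represents_src r1) (represents_src r3).
have := represents_heap r1 r2 r3 e2 e3.
have [ea1 eb1] := represents_comp r1; have [ea2 eb2] := represents_comp r2.
have [ea3 eb3] := represents_comp r3.
rewrite mulVx ea2 ract_loop1 eb2 mul1x.
by rewrite -[in emb (src h2)]ea2 ea3 ract_loop1 eb3 mul1x.
Qed.

Lemma sd_heap_src X Y Z : sd_src X = sd_src Y -> sd_src X = sd_src Z ->
  sd_src (sd_heap X Y Z) = sd_src X.
Proof.
move=> e2 e3; have r1 := represents_rep X.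
have r := represents_heap r1 (represents_rep Y) (represents_rep Z) e2 e3.
by rewrite (represents_src r) (represents_src r1).
Qed.

Lemma sd_heapA X Y Z U V : sd_src X = sd_src Y -> sd_src X = sd_src Z ->
  sd_src X = sd_src U -> sd_src X = sd_src V ->
  sd_heap (sd_heap X Y Z) U V = sd_heap X Y (sd_heap Z U V).
Proof.
move=> eY eZ eU eV; have rX := represents_rep X.
have [hY [bY [sY rY]]] := represents_src_eq rX eY.
have [hZ [bZ [sZ rZ]]] := represents_src_eq rX eZ.
have [hU [bU [sU rU]]] := represents_src_eq rX eU.
have [hV [bV [sV rV]]] := represents_src_eq rX eV.
have rl := represents_heap_common (represents_heap_common rX rY rZ) rU rV.
have rr := represents_heap_common rX rY (represents_heap_common rZ rU rV).
apply: represents_inj (rr); move: rl.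
rewrite (@twistA (src (mid_arr X))) ?heapA ?sY ?sZ ?sU ?sV//.
- exact: represents_twisted rX.
- by rewrite -sY; apply: represents_twisted rY.
- by rewrite -sZ; apply: represents_twisted rZ.
- by rewrite -sU; apply: represents_twisted rU.
- by rewrite -sV; apply: represents_twisted rV.
Qed.

Lemma sd_heapxyy X Y : sd_src X = sd_src Y -> sd_heap X Y Y = X.
Proof.
move=> eY; have rX := represents_rep X.
have [hY [bY [sY rY]]] := represents_src_eq rX eY.
apply: represents_inj (rX); have := represents_heap_common rX rY rY.
rewrite (@twistxyy (src (mid_arr X))) ?heapxyy ?sY//.
- exact: represents_twisted rX.
- by rewrite -sY; apply: represents_twisted rY.
Qed.

Lemma sd_heapxxy X Y : sd_src X = sd_src Y -> sd_heap X X Y = Y.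
Proof.
move=> eY; have rX := represents_rep X.
have [hY [bY [sY rY]]] := represents_src_eq rX eY.
apply: represents_inj (rY); have := represents_heap_common rX rX rY.
rewrite (@twistxxy (src (mid_arr X))) ?heapxxy ?sY//.
- exact: represents_twisted rX.
- by rewrite -sY; apply: represents_twisted rY.
Qed.

Lemma sd_src_mul X Y : sd_tgt X = sd_src Y -> sd_src (sd_mul X Y) = sd_src X.
Proof.
move=> e; have rX := represents_rep X; have rY := represents_rep Y.
have rXY := represents_mul rX rY e; have [es et] := sd_tgt_src rX rY e.
have [eX fX] := represents_comp rX; have [eY fY] := represents_comp rY.
rewrite (represents_src rXY) src_mul// eX.
have l : loop_at (emb (tgt (mid_arr X))) (lst_arr X * fst_arr Y).
  by split; st_tac.
by have [] := lact_loop D l.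
Qed.

Lemma sd_tgt_mul X Y : sd_tgt X = sd_src Y -> sd_tgt (sd_mul X Y) = sd_tgt Y.
Proof.
move=> e; have rY := represents_rep Y.
by rewrite (represents_tgt (represents_mul (represents_rep X) rY e)).
Qed.

Lemma sd_src_inv X : sd_src (sd_inv X) = sd_tgt X.
Proof.
by rewrite (represents_src (represents_inv (represents_rep X))) src_inv.
Qed.

Lemma sd_tgt_inv X : sd_tgt (sd_inv X) = sd_src X.
Proof.
by rewrite (represents_tgt (represents_inv (represents_rep X))) tgt_inv.
Qed.

Lemma represents_sd_one v : exists m a,
  [/\ src a = v, tgt a = emb m & represents a (one m) a^-1 (sd_one v)].
Proof.
have [[m a] /= [<- ea]] := base_arrow v.
by exists m, a; split=> //; apply: represents_one.
Qed.

Lemma sd_src_one v : sd_src (sd_one v) = v.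
Proof.
have [m [a [ea _ r]]] := represents_sd_one v.
by rewrite (represents_src r).
Qed.

Lemma sd_tgt_one v : sd_tgt (sd_one v) = v.
Proof.
have [m [a [ea _ r]]] := represents_sd_one v.
by rewrite (represents_tgt r) tgt_inv.
Qed.

Lemma sd_mulA X Y Z : sd_tgt X = sd_src Y -> sd_tgt Y = sd_src Z ->
  sd_mul X (sd_mul Y Z) = sd_mul (sd_mul X Y) Z.
Proof.
move=> e1 e2; have rX := represents_rep X; have rY := represents_rep Y.
have rZ := represents_rep Z.
have [s1 t1] := sd_tgt_src rX rY e1; have [s2 t2] := sd_tgt_src rY rZ e2.
have rYZ := represents_mul rY rZ e2; have rXY := represents_mul rX rY e1.
have rl := represents_mul rX rYZ (etrans e1 (esym (sd_src_mul e2))).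
have rr := represents_mul rXY rZ (etrans (sd_tgt_mul e1) e2).
apply: represents_inj (rr); move: rl.
have [eX fX] := represents_comp rX; have [eY fY] := represents_comp rY.
have [eZ fZ] := represents_comp rZ.
move: (fst_arr X) (mid_arr X) (lst_arr X) (fst_arr Y) (mid_arr Y) (lst_arr Y)
  (fst_arr Z) (mid_arr Z) (lst_arr Z) s1 t1 s2 t2 eX fX eY fY eZ fZ.
move=> a1 h1 b1 a2 h2 b2 a3 h3 b3 s1 t1 s2 t2 eX fX eY fY eZ fZ.
have l1 : loop_at (emb (tgt h1)) (b1 * a2) by split; st_tac.
have l2 : loop_at (emb (tgt h2)) (b2 * a3) by split; st_tac.
have l3 := lact_loop D l2; have l4 := lact_loop D l1.
rewrite -t1 in l3; have l5 := lact_loop D l3.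
have [? ?] := l1; have [? ?] := l2; have [? ?] := l3; have [? ?] := l4.
have [? ?] := l5.
have <- : a1 * lact D h1 (b1 * (a2 * lact D h2 (b2 * a3))) =
    a1 * lact D h1 (b1 * a2) * lact D (h1 * h2) (b2 * a3).
  rewrite lact_mul// -[RHS]mulA; [|by st_tac..].
  by rewrite -lactM// -mulA//; st_tac.
by rewrite (mulA t1 t2).
Qed.

Lemma sd_mul1x X : sd_mul (sd_one (sd_src X)) X = X.
Proof.
have rX := represents_rep X; have [eX fX] := represents_comp rX.
have r1 := represents_one eX.
have r := represents_mul r1 rX (sd_tgt_one _).
apply: represents_inj (rX); move: r.
by rewrite mulVx eX -[in emb (src _)](tgt_one (src (mid_arr X))) lact_loop1
  src_one -eX mulx1 mul1x.
Qed.

Lemma sd_mulVx X : sd_mul (sd_inv X) X = sd_one (sd_tgt X).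
Proof.
have rX := represents_rep X; have [eX fX] := represents_comp rX.
have rV := represents_inv rX.
have r := represents_mul rV rX (sd_tgt_inv _).
have r1 := @represents_one (tgt (mid_arr X)) (lst_arr X)^-1.
rewrite tgt_inv src_inv invK in r1; have {}r1 := r1 (esym fX).
apply: represents_inj r1; move: r.
rewrite mulVx mulVx eX -(tgt_inv (mid_arr X)) lact_loop1 src_inv fX.
by rewrite -tgt_inv mulx1.
Qed.

Lemma sd_inv_inv X : sd_inv (sd_inv X) = X.
Proof.
have rX := represents_rep X; have := represents_inv (represents_inv rX).
by rewrite !invK => r; apply: represents_inj r rX.
Qed.

Lemma sd_mulxV X : sd_mul X (sd_inv X) = sd_one (sd_src X).
Proof. by rewrite -{1}(sd_inv_inv X) sd_mulVx sd_tgt_inv. Qed.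

Lemma sd_mulx1 X : sd_mul X (sd_one (sd_tgt X)) = X.
Proof.
rewrite -sd_mulVx sd_mulA ?sd_src_inv ?sd_tgt_inv// sd_mulxV.
exact: sd_mul1x.
Qed.

Definition semidirect_groupoid : groupoid :=
  Groupoid sd_src_one sd_tgt_one sd_src_inv sd_tgt_inv sd_src_mul sd_tgt_mul
    sd_mulA sd_mul1x sd_mulx1 sd_mulVx sd_mulxV.

Lemma sd_src_opp X : sd_src (sd_opp X) = sd_src X.
Proof. by rewrite sd_heap_src !sd_src_one. Qed.
Lemma sd_src_add X Y : sd_src X = sd_src Y -> sd_src (sd_add X Y) = sd_src X.
Proof. by move=> e; rewrite sd_heap_src ?sd_src_one. Qed.
Lemma sd_addA X Y Z : sd_src X = sd_src Y -> sd_src Y = sd_src Z ->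
  sd_add X (sd_add Y Z) = sd_add (sd_add X Y) Z.
Proof.
move=> e1 e2; rewrite /sd_add -sd_heapA ?sd_src_one -?e2//.
by rewrite sd_heap_src ?sd_src_one -?e2 ?e1.
Qed.
Lemma sd_add0x X : sd_add (sd_one (sd_src X)) X = X.
Proof. by rewrite /sd_add sd_src_one sd_heapxxy ?sd_src_one. Qed.
Lemma sd_addx0 X : sd_add X (sd_one (sd_src X)) = X.
Proof. by rewrite /sd_add sd_heapxyy ?sd_src_one. Qed.
Lemma sd_addNx X : sd_add (sd_opp X) X = sd_one (sd_src X).
Proof.
rewrite /sd_add sd_src_opp sd_heapA ?sd_src_one//.
by rewrite sd_heapxxy ?sd_src_one// sd_heapxyy ?sd_src_one.
Qed.
Lemma sd_addxN X : sd_add X (sd_opp X) = sd_one (sd_src X).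
Proof.
rewrite /sd_add -sd_heapA ?sd_src_one//.
by rewrite sd_heapxyy ?sd_src_one// sd_heapxxy ?sd_src_one.
Qed.

(* The product of [N] and [H] along [D]. It always is a groupoid with a group
   structure on each star; skew left distributivity does not follow from the
   axioms of [semidirect_data]. *)
Definition semidirect : star_groupoid :=
  @StarGroupoid semidirect_groupoid sd_one sd_opp sd_add sd_src_one sd_src_opp
    sd_src_add sd_addA sd_add0x sd_addx0 sd_addNx sd_addxN.

Lemma semidirect_heap (X Y Z : semidirect) :
  src X = src Y -> src Y = src Z -> heap X Y Z = sd_heap X Y Z.
Proof.
rewrite /heap /= => e1 e2.
have s1 : sd_src (sd_opp Y) = sd_src Y := sd_src_opp Y.
rewrite /sd_add sd_heap_src ?sd_src_one ?s1//.
rewrite /sd_opp -e1 -sd_heapA ?sd_src_one//.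
rewrite sd_heapxyy ?sd_src_one// sd_heapA ?sd_src_one -?e2//.
by rewrite sd_heapxxy ?sd_src_one// -e2.
Qed.

End Semidirect.

(* The data given by conjugation in [G], for a splitting [s] of [f] whose image
   is identified with [H]. *)
Definition conjugation_data (G H : qsb) (f : star_mor G H) (s : star_mor H G)
    (D : @semidirect_data (kernel f) H (mor0 s)) :=
  let i := kernel_incl f in
  [/\ forall (h : H) (l : kernel f),
        @loop_at (kernel f) (mor0 s (tgt h)) l ->
        i (lact D h l) = s h * i l * (s h)^-1,
      forall (h : H) (a : kernel f), src a = mor0 s (src h) ->
        i (phi D h a) = - s h + i a + s h
    & forall (h : H) (a : kernel f), src a = mor0 s (tgt h) ->
        i (gamma D h a) = - s h + s h * i a].

(* Main.v *)
(** Left multiplication by [h] turns the twisted addition into the addition of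
    [G]: [<h1,h2,h3> T(b1,b2,b3) = <h1 b1, h2 b2, h3 b3>]. With the skew left
    distributivity [a <x,y,z> = <a x, a y, a z>] this makes the map sending the
    class of [(a, h, b)] to the product [a h b] in [G] a morphism of quiver skew
    braces. It is bijective: an arrow [x] of [G] determines [h = f x], any kernel
    arrow [a] from [src x] to the source of [s h] determines [b], and two choices
    of [a] differ by a loop, which is exactly what the tensor relation absorbs.
    Skew left distributivity of the product is transported from [G]. *)
From mathcomp Require Import all_boot boolp.
Require Import Defs.

Set Implicit Arguments.
Unset Strict Implicit.
Unset Printing Implicit Defensive.

Local Open Scope qsb_scope.

(** Each law for [g1] is the law for [F] read backwards through the cancellations. The isomorphism
    produced is the inverse of [F], because the evaluation map built below goes from the product to
    [G]. *)
Lemma bijective_is_iso (G H : star_groupoid) (F : star_mor G H) g0 g1 :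
  cancel (mor0 F) g0 -> cancel g0 (mor0 F) -> cancel F g1 -> cancel g1 F ->
  exists g : star_mor H G, is_iso g.
Proof.
move=> F0K g0K F1K g1K.
have s1 y : src (g1 y) = g0 (src y) by rewrite -[y in RHS]g1K mor_src F0K.
have t1 y : tgt (g1 y) = g0 (tgt y) by rewrite -[y in RHS]g1K mor_tgt F0K.
have m1 x y : tgt x = src y -> g1 (x * y) = g1 x * g1 y.
  by move=> e; rewrite -[RHS]F1K mor_mul ?g1K// t1 s1 e.
have a1 x y : src x = src y -> g1 (x + y) = g1 x + g1 y.
  by move=> e; rewrite -[RHS]F1K mor_add ?g1K// !s1 e.
pose g := @StarMor H G (GroupoidMor s1 t1 m1) a1.
by exists g, F.
Qed.

Ltac add_cancel :=
  repeat (rewrite -addA; [|by st_tac..]);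
  repeat first [ rewrite addKx; [|by st_tac] | rewrite addKVx; [|by st_tac] ].

(** * Additive and multiplicative identities in a quiver skew brace *)

Section QsbIdentities.
Variable G : qsb.
Implicit Types a b c d h k : G.

Lemma opp_zero (v : vert G) : - zero v = zero v :> G.
Proof. by symmetry; apply: opp_uniq; rewrite // zero_add0 src_zero. Qed.

(** Expanding $a = a(b - b) = ab - a + a(-b)$ by skew distributivity and solving for the last
    term. *)
Lemma mul_opp a b : tgt a = src b -> a * (- b) = a - a * b + a.
Proof.
move=> e; have sb := src_opp b.
have := @skew_distr G a b (- b) e; rewrite sb => /(_ erefl).
rewrite addxN zero_one -e mulx1 => E.
apply: (@addIx _ (a * b - a)); [by st_tac..|].
by rewrite -E; add_cancel.
Qed.

Lemma mul_heap a b c d : tgt a = src b -> src b = src c -> src c = src d ->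
  a * heap b c d = heap (a * b) (a * c) (a * d).
Proof.
move=> eb ec ed; rewrite /heap skew_distr; [|by st_tac..].
rewrite skew_distr; [|by st_tac..].
rewrite mul_opp; last by st_tac.
by add_cancel.
Qed.

(** The expression [- h + h * a] is $h\rightharpoonup a$. This lemma and the next make it an action
    by additive maps, as required of [gamma]. *)
Lemma harpoonD h a b : src a = tgt h -> src b = tgt h ->
  - h + h * (a + b) = - h + h * a + (- h + h * b).
Proof.
by move=> ea eb; rewrite skew_distr ?addA//; st_tac.
Qed.

Lemma harpoon_mul h k a : tgt h = src k -> src a = tgt k ->
  - (h * k) + h * k * a = - h + h * (- k + k * a).
Proof.
move=> e ea; rewrite skew_distr; [|by st_tac..].
rewrite mul_opp; last by st_tac.
by rewrite mulA//; add_cancel.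
Qed.

(** Here $h(-h^{-1}) = h - 1 + h = h + h$, since the unit is the additive zero. The identity serves
    to remove the outer [gamma] at an inverse in [twist]. *)
Lemma mul_harpoonV h a : src a = src h -> h * (- h^-1 + h^-1 * a) = h + a.
Proof.
move=> e; rewrite skew_distr; [|by st_tac..].
rewrite mul_opp; last by st_tac.
rewrite mulKVx// mulxV -zero_one opp_zero.
by rewrite addx0; add_cancel.
Qed.

(** With $c_j = h_j b_j$, the left side is the heap to which [twist] applies its outer [gamma]. The
    conjugations telescope and leave $-h_3 + h_2 - h_1$, the opposite of $\langle
    h_1,h_2,h_3\rangle$, in front of $c_1 - c_2 + c_3$. *)
Lemma twist_add h1 h2 h3 c1 c2 c3 :
  src h1 = src h2 -> src h2 = src h3 ->
  src c1 = src h1 -> src c2 = src h2 -> src c3 = src h3 ->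
  heap (- h3 + (- - h2 + (- h1 + c1) - h2) + h3)
       (- h3 + (- - h2 + (- h2 + c2) - h2) + h3) (- h3 + c3) =
  - heap h1 h2 h3 + heap c1 c2 c3.
Proof.
move=> e12 e23 e1 e2 e3; rewrite /heap oppK addKVx; last by st_tac.
repeat (rewrite oppD; [|by st_tac]); rewrite !oppK.
by add_cancel.
Qed.

End QsbIdentities.

Lemma mor_heap (G H : star_groupoid) (F : star_mor G H) x y z :
  src x = src y -> src y = src z ->
  F (heap x y z) = heap (F x) (F y) (F z).
Proof. by move=> *; rewrite /heap !mor_add ?mor_opp; st_tac. Qed.

(** * Conjugation actions and the twist, computed in an ambient quiver skew brace *)

Section Internal.
Variables (G N H : qsb) (i : star_mor N G) (s : star_mor H G).
Variable emb : vert H -> vert N.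
Hypothesis mor0_emb : forall m, mor0 i (emb m) = mor0 s m.
Implicit Types (h k : H) (a b c l : N).

Lemma mor0_at v m : v = emb m -> mor0 i v = mor0 s m.
Proof. by move=> ->. Qed.

(** The actions are bare functions here: the lemmas must be available before a [semidirect_data]
    exists, since they supply its field [twist_loop]. *)
Definition lact_conj (lact : H -> N -> N) := forall h l,
  loop_at (emb (tgt h)) l -> i (lact h l) = s h * i l * (s h)^-1.
Definition phi_conj (phi : H -> N -> N) := forall h a,
  src a = emb (src h) -> i (phi h a) = - s h + i a + s h.
Definition gamma_conj (gamma : H -> N -> N) := forall h a,
  src a = emb (tgt h) -> i (gamma h a) = - s h + s h * i a.

(** By [mul_harpoonV] the product becomes a sum with first term $\langle h_1,h_2,h_3\rangle$, which
    cancels against its opposite from [twist_add]. *)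
Lemma mul_twist (phi gamma : H -> N -> N) h1 h2 h3 b1 b2 b3 :
  (forall h a, src a = emb (src h) -> src (phi h a) = src a) ->
  (forall h a, src a = emb (tgt h) -> src (gamma h a) = emb (src h)) ->
  phi_conj phi -> gamma_conj gamma ->
  src h1 = src h2 -> src h2 = src h3 ->
  src b1 = emb (tgt h1) -> src b2 = emb (tgt h2) -> src b3 = emb (tgt h3) ->
  s (heap h1 h2 h3) * i (twist phi gamma h1 h2 h3 b1 b2 b3) =
  heap (s h1 * i b1) (s h2 * i b2) (s h3 * i b3).
Proof.
move=> src_phi src_gamma phiE gammaE e12 e23 e1 e2 e3.
have s1 := src_gamma _ _ e1; have s2 := src_gamma _ _ e2.
have s3 := src_gamma _ _ e3.
have sh c : src c = emb (src h1) -> src (phi h3 (phi (- h2) c)) = emb (src h1).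
  by move=> e; rewrite !src_phi ?src_opp ?e; congruence.
have shE c : src c = emb (src h1) ->
    i (phi h3 (phi (- h2) c)) = - s h3 + (- - s h2 + i c - s h2) + s h3.
  by move=> e; rewrite !phiE ?src_phi ?src_opp ?mor_opp; congruence.
have eA : src (heap h1 h2 h3) = src h1 by rewrite src_heap.
rewrite /twist gammaE ?tgt_inv ?eA; last by rewrite src_heap ?sh; congruence.
rewrite mor_inv mul_harpoonV; last first.
  by rewrite mor_src src_heap ?sh// ?mor0_emb; st_tac.
rewrite !mor_heap ?shE ?gammaE ?sh; [|congruence..].
have t1 := mor0_at e1; have t2 := mor0_at e2; have t3 := mor0_at e3.
rewrite twist_add; [|by st_tac..].
by rewrite addKVx//; rewrite !src_heap; st_tac.
Qed.

Lemma mul_lact_inv lact h l : lact_conj lact -> loop_at (emb (src h)) l ->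
  s h * i (lact h^-1 l) = i l * s h.
Proof.
move=> lactE ll; have [/mor0_at sl /mor0_at tl] := ll.
rewrite lactE ?tgt_inv// mor_inv invK.
by rewrite -mulA ?mulKVx//; st_tac.
Qed.

Lemma mul_lact_inv_mul lact h l b : lact_conj lact ->
  loop_at (emb (src h)) l -> loop_at (emb (tgt h)) (lact h^-1 l) ->
  src b = emb (tgt h) ->
  s h * i (lact h^-1 l * b) = i l * (s h * i b).
Proof.
move=> lactE ll lr eb; have [/mor0_at sl /mor0_at tl] := ll.
have [_ tr] := lr; have [/mor0_at sr /mor0_at tr'] := lr.
have sb := mor0_at eb.
rewrite mor_mul ?tr// mulA; [|by st_tac..].
by rewrite mul_lact_inv// -mulA//; st_tac.
Qed.

Lemma src_twisted (phi gamma : H -> N -> N) h1 h2 h3 b1 b2 b3 :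
  (forall h a, src a = emb (src h) -> src (phi h a) = src a) ->
  (forall h a, src a = emb (tgt h) -> src (gamma h a) = emb (src h)) ->
  src h1 = src h2 -> src h2 = src h3 ->
  src b1 = emb (tgt h1) -> src b2 = emb (tgt h2) -> src b3 = emb (tgt h3) ->
  src (twist phi gamma h1 h2 h3 b1 b2 b3) = emb (tgt (heap h1 h2 h3)).
Proof.
move=> src_phi src_gamma e12 e23 e1 e2 e3.
have s1 := src_gamma _ _ e1; have s2 := src_gamma _ _ e2.
have s3 := src_gamma _ _ e3.
have sh c : src c = emb (src h1) -> src (phi h3 (phi (- h2) c)) = emb (src h1).
  by move=> e; rewrite !src_phi ?src_opp ?e; congruence.
by rewrite /twist src_gamma ?src_inv// tgt_inv !src_heap// ?sh; congruence.
Qed.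

(** After left multiplication by $\langle h_1,h_2,h_3\rangle$, both sides reduce to the heap of the
    $h_j b_j$ multiplied on the left by $\ell$: conjugation lets $\ell$ pass each $h_j$, and
    [mul_heap] takes it out of the heap. *)
Lemma twist_conj_loop (lact phi gamma : H -> N -> N) h1 h2 h3 b1 b2 b3 l :
  injective i ->
  (forall h l, loop_at (emb (tgt h)) l -> loop_at (emb (src h)) (lact h l)) ->
  (forall h a, src a = emb (src h) -> src (phi h a) = src a) ->
  (forall h a, src a = emb (tgt h) -> src (gamma h a) = emb (src h)) ->
  lact_conj lact -> phi_conj phi -> gamma_conj gamma ->
  src h1 = src h2 -> src h2 = src h3 ->
  src b1 = emb (tgt h1) -> src b2 = emb (tgt h2) -> src b3 = emb (tgt h3) ->
  loop_at (emb (src h1)) l ->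
  twist phi gamma h1 h2 h3
    (lact h1^-1 l * b1) (lact h2^-1 l * b2) (lact h3^-1 l * b3) =
  lact (heap h1 h2 h3)^-1 l * twist phi gamma h1 h2 h3 b1 b2 b3.
Proof.
move=> i_inj llact src_phi src_gamma lactE phiE gammaE e12 e23 e1 e2 e3 ll.
have lr h : src h = src h1 -> loop_at (emb (tgt h)) (lact h^-1 l).
  by move=> e; rewrite -src_inv; apply: llact; rewrite tgt_inv e.
have slb h b : src h = src h1 -> src b = emb (tgt h) ->
    src (lact h^-1 l * b) = emb (tgt h).
  by move=> /lr[sl tl] eb; rewrite src_mul// tl.
have sK : src (heap h1 h2 h3) = src h1 by rewrite src_heap.
have sT := src_twisted src_phi src_gamma e12 e23 e1 e2 e3.
have sT' := src_twisted src_phi src_gamma e12 e23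
  (slb _ _ erefl e1) (slb _ _ (esym e12) e2)
  (slb _ _ (esym (etrans e12 e23)) e3).
have [/mor0_at sl /mor0_at tl] := ll.
have t1 := mor0_at e1; have t2 := mor0_at e2; have t3 := mor0_at e3.
apply/i_inj/(@mulI _ (s (heap h1 h2 h3))).
- by rewrite mor_tgt mor_src sT' mor0_emb.
- by rewrite mor_tgt mor_src (slb _ _ sK sT) mor0_emb.
rewrite (mul_lact_inv_mul lactE _ (lr _ sK) sT) ?sK//.
rewrite !mul_twist//; try by apply: slb; congruence.
rewrite !mul_lact_inv_mul//; try by [apply: lr; congruence | congruence].
by rewrite mul_heap//; st_tac.
Qed.

End Internal.

(** * The evaluation map from the semidirect product to the ambient brace *)

Section InternalProduct.
Variables (G N H : qsb) (i : star_mor N G) (s : star_mor H G).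
Variables (f : star_mor G H) (emb : vert H -> vert N).
Variable D : semidirect_data emb.
Hypothesis mor0_emb : forall m, mor0 i (emb m) = mor0 s m.
Hypotheses (lactE : lact_conj i s emb (lact D))
  (phiE : phi_conj i s emb (phi D)) (gammaE : gamma_conj i s emb (gamma D)).
Implicit Types (h k : H) (a b : N) (X Y Z : semidirect D).

Local Notation at_emb := (mor0_at mor0_emb).

Definition sd_val X : G := i (fst_arr X) * s (mid_arr X) * i (lst_arr X).

(** Two representatives differ by a loop $\ell$ moved across $h$, and $h(h^{-1}\ell h) = \ell h$ in
    [G]. *)
Lemma sd_valE a h b X : represents a h b X -> sd_val X = i a * s h * i b.
Proof.
move=> r; rewrite /sd_val.
have [eh [l [ll -> ->]]] := represents_rel (represents_rep X) r.
have [ea eb] := represents_comp (represents_rep X).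
have [_ eb'] := represents_comp r.
rewrite eh in ll ea eb eb' *; have [sl tl] := ll.
have lr := ract_loop D ll; have [sr tr] := lr.
have s1 := at_emb ea; have s2 := at_emb (esym eb'); have s3 := at_emb sl.
have s4 := at_emb tl.
have sr' := at_emb sr; have tr' := at_emb tr.
rewrite !mor_mul ?tr ?sl//; rewrite /ract in sr' tr' *.
rewrite -mulA; [|by st_tac..].
rewrite [s h * _]mulA; [|by st_tac..].
rewrite (mul_lact_inv mor0_emb lactE ll).
by repeat (rewrite mulA; [|by st_tac..]).
Qed.

Lemma sd_val_src X : src (sd_val X) = mor0 i (sd_src X).
Proof.
have [ea eb] := represents_comp (represents_rep X).
have ea' := at_emb ea; have eb' := at_emb (esym eb).
by rewrite /sd_val /sd_src /sd_tgt; st_tac.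
Qed.

Lemma sd_val_tgt X : tgt (sd_val X) = mor0 i (sd_tgt X).
Proof.
have [ea eb] := represents_comp (represents_rep X).
have ea' := at_emb ea; have eb' := at_emb (esym eb).
by rewrite /sd_val /sd_src /sd_tgt; st_tac.
Qed.

Lemma sd_val_mul X Y : sd_tgt X = sd_src Y ->
  sd_val (sd_mul X Y) = sd_val X * sd_val Y.
Proof.
move=> e; have r1 := represents_rep X; have r2 := represents_rep Y.
have [e1 e2] := sd_tgt_src r1 r2 e.
have [/at_emb a1 b1] := represents_comp r1.
have [a2 b2] := represents_comp r2.
have ll : loop_at (emb (tgt (mid_arr X))) (lst_arr X * fst_arr Y).
  by split; st_tac.
have [/at_emb sc /at_emb tc] := lact_loop D ll.
have [sc' tc'] := lact_loop D ll.
have [ea1 _] := represents_comp r1.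
have {}b1 := at_emb (esym b1); have {}b2 := at_emb (esym b2).
have {}a2 := at_emb a2; have e1' := congr1 (mor0 i) e1.
have e2' := congr1 (mor0 s) e2.
rewrite (sd_valE (represents_mul r1 r2 e)) /sd_val mor_mul ?sc'//.
rewrite lactE// !mor_mul//.
repeat (rewrite -mulA; [|by st_tac..]).
(* The inverse of the first middle arrow, left by the conjugation, cancels against that arrow in the
   product of the two middle arrows. *)
by rewrite mulKx//; st_tac.
Qed.

(** Representatives with a common first arrow reduce the heap to [twist]. Then [mul_twist] applies,
    and [mul_heap] distributes the common arrow. *)
Lemma sd_val_heap X Y Z : sd_src X = sd_src Y -> sd_src X = sd_src Z ->
  sd_val (sd_heap X Y Z) = heap (sd_val X) (sd_val Y) (sd_val Z).
Proof.
move=> eY eZ; have rX := represents_rep X.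
have [hY [bY [sY rY]]] := represents_src_eq rX eY.
have [hZ [bZ [sZ rZ]]] := represents_src_eq rX eZ.
have r := represents_heap_common rX rY rZ.
rewrite (sd_valE r) (sd_valE rX) (sd_valE rY) (sd_valE rZ).
have [/at_emb ea /esym eX] := represents_comp rX.
have [_ /esym eY'] := represents_comp rY; have [_ /esym eZ'] := represents_comp rZ.
have [_ /esym/at_emb et] := represents_comp r.
have tX := at_emb eX; have tY := at_emb eY'; have tZ := at_emb eZ'.
have sY' := congr1 (mor0 s) sY; have sZ' := congr1 (mor0 s) sZ.
have e12 : src (mid_arr X) = src hY by [].
have e23 : src hY = src hZ by rewrite sY.
have sK : src (heap (mid_arr X) hY hZ) = src (mid_arr X) by rewrite src_heap.
rewrite -!mulA; [|by st_tac..].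
rewrite (mul_twist mor0_emb) ?mul_heap//; try by st_tac.
- by move=> *; apply: src_phi.
- by move=> *; apply: src_gamma.
Qed.

Lemma sd_val_add X Y : sd_src X = sd_src Y ->
  sd_val (sd_add X Y) = sd_val X + sd_val Y.
Proof.
move=> e; rewrite /sd_add sd_val_heap ?sd_src_one//.
have [m [a [ea ta r]]] := represents_sd_one D (sd_src X).
(* The unit class evaluates to $a a^{-1}$, a unit of [G] and hence an additive zero. *)
have -> : sd_val (sd_one D (sd_src X)) = zero (mor0 i (sd_src X)).
  have ta' := at_emb ta.
  rewrite (sd_valE r) mor_one -ta' -mor_tgt mulx1 mor_inv mulxV zero_one.
  by rewrite mor_src ea.
by rewrite -sd_val_src /heap opp_zero addx0.
Qed.

Definition sd_val_mor : star_mor (semidirect D) G :=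
  @StarMor (semidirect D) G (@GroupoidMor (semidirect D) G (mor0 i) sd_val
    sd_val_src sd_val_tgt sd_val_mul) sd_val_add.

Hypotheses (i_inj : injective i) (mor0_i_inj : injective (mor0 i))
  (sK : cancel s f) (f_incl : forall a, f (i a) = one (mor0 f (src (i a)))).

Let mor0_fs m : mor0 f (mor0 s m) = m.
Proof. by rewrite -[m in mor0 s m]src_one -!mor_src sK src_one. Qed.

Let mor0_f_incl a : mor0 f (src (i a)) = mor0 f (tgt (i a)).
Proof. by rewrite -mor_tgt f_incl tgt_one. Qed.

(** Once both classes have the same first arrow, it cancels. Then [f] recovers the middle arrow, and
    a second cancellation gives the last one. *)
Lemma sd_val_inj : injective sd_val.
Proof.
move=> X Y e.
have es : sd_src X = sd_src Y by apply: mor0_i_inj; rewrite -!sd_val_src e.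
have rX := represents_rep X; have [k [d [sk rY]]] := represents_src_eq rX es.
move: e; rewrite (sd_valE rX) (sd_valE rY).
move: (fst_arr X) (mid_arr X) (lst_arr X) rX rY sk => a h b rX rY sk.
have [/at_emb ea /esym/at_emb eb] := represents_comp rX.
have [_ /esym/at_emb ed] := represents_comp rY.
have sk' := congr1 (mor0 s) sk.
rewrite -!mulA; [|by st_tac..] => /mulI E.
have {}E : s h * i b = s k * i d by apply: E; st_tac.
have fE g c : mor0 i (src c) = mor0 s (tgt g) -> f (s g * i c) = g.
  move=> ec; rewrite mor_mul; last by st_tac.
  by rewrite sK f_incl mor_src ec mor0_fs mulx1.
have ehk : h = k by rewrite -(fE _ _ eb) E fE.
subst k; have bd : b = d by apply/i_inj/(mulI _ _ E); st_tac.
by rewrite -bd in rY; apply: represents_inj rX rY.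
Qed.

Lemma sd_val_surj : (forall v, exists w, mor0 i w = v) ->
  (forall x : G, f x = one (mor0 f (src x)) -> exists a, i a = x) ->
  forall x, exists X, sd_val X = x.
Proof.
move=> i0_surj i_surj x; have [v ev] := i0_surj (src x).
have [[m a] /= [sa ta]] := base_arrow D v.
have ta' := at_emb ta; have sa' := congr1 (mor0 i) sa.
(* The kernel arrow [a] joins [v] to [emb m], and [f] identifies its two ends. *)
have em : src (f x) = m.
  by rewrite mor_src -ev -sa' -mor_src mor0_f_incl mor_tgt ta' mor0_fs.
have em' := congr1 (mor0 s) em; rewrite mor_src in em'.
(* The last arrow is forced by the equation $x = a\, s(f(x))\, y$. It lies in the kernel because its
   image is $f(x)^{-1} f(x)$. *)
pose y := (s (f x))^-1 * ((i a)^-1 * x).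
have sy : src y = tgt (s (f x)) by rewrite /y; st_tac.
have [|b eb] := i_surj y.
  rewrite sy mor_tgt mor0_fs /y !mor_mul ?mor_inv ?sK ?f_incl; [|by st_tac..].
  have -> : mor0 f (src (i a)) = src (f x).
    by rewrite mor0_f_incl mor_tgt ta' mor0_fs.
  by rewrite inv_one mul1x mulVx.
have e1 : tgt a = emb (src (f x)) by rewrite em.
have e2 : emb (tgt (f x)) = src b.
  by apply: mor0_i_inj; rewrite mor0_emb -mor_src eb sy [RHS]mor_tgt.
have [X r] := represents_ex D e1 e2; exists X.
rewrite (sd_valE r) eb /y -mulA; [|by st_tac..].
by rewrite mulKVx ?mulKVx//; st_tac.
Qed.

End InternalProduct.

(** * The kernel of a split exact sequence and its conjugation data *)

Section Splitting.
Variables (G H : qsb) (f : star_mor G H) (s : star_mor H G).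
Hypotheses (f_exact : induces_iso f) (fs : is_splitting f s).
Let N := kernel f.
Local Notation i := (kernel_incl f).
Implicit Types (h k : H) (a b c l : N).

(* [st_tac] compares terms syntactically, so sources and targets in the kernel
   are first rewritten to sources and targets in [G]. *)
Lemma ker_src a : @src N a = src (val a). Proof. by []. Qed.
Lemma ker_tgt a : @tgt N a = tgt (val a). Proof. by []. Qed.

Lemma ker_loop (v : vert G) l :
  @loop_at N v l -> src (val l) = v /\ tgt (val l) = v.
Proof. by []. Qed.

Lemma kernel_incl_inj : injective i. Proof. exact: val_inj. Qed.

(** Exactness enters here: the induced isomorphism is injective on vertices, which in the quotient
    are the components of the kernel. *)
Lemma ker_connectedP (v w : vert G) :
  ker_connected f v w <-> mor0 f v = mor0 f w.
Proof.
split; first exact: ker_connected_mor0.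
have [F [F0 _ [g [[F0K _] _]]]] := f_exact.
by rewrite -!F0 => /(can_inj F0K)/quot_vertP.
Qed.

Lemma splitting_component (v : vert N) :
  exists! m : vert H, @connected N v (mor0 s m).
Proof.
have [mor0K _] := fs.
exists (mor0 f v); split; first by apply/ker_connectedP; rewrite mor0K.
by move=> m /ker_connectedP ->; rewrite mor0K.
Qed.

(** In these three definitions [insubd] falls back on the given kernel arrow if the value is outside
    the kernel. On the meaningful arguments this never happens: [f] sends the values to $hh^{-1}$,
    $-h+h$ and $-h+h1$, all units. *)
Definition ker_lact h l : N := insubd l (s h * val l * (s h)^-1).
Definition ker_phi h a : N := insubd a (- s h + val a + s h).
Definition ker_gamma h a : N := insubd a (- s h + s h * val a).

Lemma val_ker_lact h l : @loop_at N (mor0 s (tgt h)) l ->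
  val (ker_lact h l) = s h * val l * (s h)^-1.
Proof.
have [mor0K morK] := fs.
move=> /ker_loop[sl tl]; apply: insubdK; apply/in_kernelP.
rewrite !mor_mul ?mor_inv ?morK; [|by st_tac..].
rewrite kerP sl mor0K mulx1 mulxV; congr one.
by rewrite !src_mul ?mor_src ?mor0K; st_tac.
Qed.

Lemma val_ker_phi h a : @src N a = mor0 s (src h) ->
  val (ker_phi h a) = - s h + val a + s h.
Proof.
have [mor0K morK] := fs.
rewrite ker_src => sa; apply: insubdK; apply/in_kernelP.
rewrite !mor_add ?mor_opp ?morK; [|by st_tac..].
rewrite kerP sa mor0K -zero_one -src_opp addx0 addNx zero_one; congr one.
by rewrite !src_add ?src_opp ?mor_src ?mor0K; st_tac.
Qed.

Lemma val_ker_gamma h a : @src N a = mor0 s (tgt h) ->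
  val (ker_gamma h a) = - s h + s h * val a.
Proof.
have [mor0K morK] := fs.
rewrite ker_src => sa; apply: insubdK; apply/in_kernelP.
rewrite !mor_add ?mor_mul ?mor_opp ?morK; [|by st_tac..].
rewrite kerP sa mor0K mulx1 addNx zero_one; congr one.
by rewrite !src_add ?src_opp ?mor_src ?mor0K; st_tac.
Qed.

Lemma ker_lact_loop h l : @loop_at N (mor0 s (tgt h)) l ->
  @loop_at N (mor0 s (src h)) (ker_lact h l).
Proof.
move=> ll; have [? ?] := ker_loop ll.
by split; rewrite ?ker_src ?ker_tgt val_ker_lact//; st_tac.
Qed.

Lemma src_ker_phi h a : @src N a = mor0 s (src h) ->
  @src N (ker_phi h a) = src a.
Proof.
move=> sa; rewrite !ker_src val_ker_phi//.
by move: sa; rewrite ker_src => ?; st_tac.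
Qed.

Lemma src_ker_gamma h a : @src N a = mor0 s (tgt h) ->
  @src N (ker_gamma h a) = mor0 s (src h).
Proof.
move=> sa; rewrite !ker_src val_ker_gamma//.
by move: sa; rewrite ker_src => ?; st_tac.
Qed.

Lemma conjugation_data_exists :
  exists D : @semidirect_data N H (mor0 s), conjugation_data D.
Proof.
have [mor0K morK] := fs.
unshelve eexists (@SemidirectData N H (mor0 s) (can_inj mor0K)
  splitting_component ker_lact ker_lact_loop _ _ _
  ker_phi src_ker_phi _ _ _ ker_gamma src_ker_gamma _ _ _ _).
(* The goals are three laws for [lact], three for [phi], three for [gamma], and finally
   [twist_loop]; all are checked in [G]. *)
- move=> h x y lx ly; have lxy := loop_mul lx ly.
  have [sx tx] := ker_loop lx; have [sy ty] := ker_loop ly.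
  have [/= sx' tx'] := ker_lact_loop lx; have [/= sy' ty'] := ker_lact_loop ly.
  apply: val_inj; rewrite val_ker_lact// !val_ker_mul ?tx' ?tx//.
  rewrite !val_ker_lact//.
  repeat (rewrite -mulA; [|by st_tac..]).
  by rewrite mulKx; st_tac.
- move=> h k x e lx; have [sx tx] := ker_loop lx; apply: val_inj.
  have lx' := ker_lact_loop lx; rewrite -e in lx'.
  have e' := congr1 (mor0 s) e.
  rewrite !val_ker_lact ?tgt_mul// mor_mul// invM; last by st_tac.
  by rewrite !mulA//; st_tac.
- move=> m x lx; have [sx tx] := ker_loop lx; apply: val_inj.
  rewrite val_ker_lact ?tgt_one// mor_one inv_one.
  by rewrite -{1}sx mul1x -tx mulx1.
- move=> h a b sa sb; have [sa' sb'] := (sa, sb); rewrite !ker_src in sa' sb'.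
  have := src_ker_phi sa; have := src_ker_phi sb; rewrite !ker_src => pb pa.
  have sab : @src N (a + b) = mor0 s (src h) by rewrite src_add// sa.
  apply: val_inj; rewrite val_ker_phi// !val_ker_add ?pa ?pb ?sa' ?sb'//.
  by rewrite !val_ker_phi//; add_cancel.
- move=> h k a e sa; have sa' := sa; have e' := congr1 (mor0 s) e.
  rewrite ker_src in sa'; apply: val_inj.
  have sp : @src N (ker_phi h a) = mor0 s (src k) by rewrite src_ker_phi// -e.
  rewrite !val_ker_phi ?src_add// mor_add// oppD; last by st_tac.
  by add_cancel.
- move=> m a sa; have sa' := sa; rewrite ker_src in sa'; apply: val_inj.
  rewrite val_ker_phi ?src_zero// mor_zero opp_zero -sa' add0x.
  by rewrite addx0.
- move=> h a b sa sb; have [sa' sb'] := (sa, sb); rewrite !ker_src in sa' sb'.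
  have := src_ker_gamma sa; have := src_ker_gamma sb; rewrite !ker_src => pb pa.
  have sab : @src N (a + b) = mor0 s (tgt h) by rewrite src_add// sa.
  apply: val_inj; rewrite val_ker_gamma// !val_ker_add ?pa ?pb ?sa' ?sb'//.
  by rewrite !val_ker_gamma// harpoonD//; st_tac.
- move=> h k a e sa; have sa' := sa; have e' := congr1 (mor0 s) e.
  rewrite ker_src in sa'; apply: val_inj.
  have sp : @src N (ker_gamma k a) = mor0 s (tgt h).
    by rewrite src_ker_gamma// -e.
  rewrite !val_ker_gamma ?tgt_mul// mor_mul//.
  by apply: harpoon_mul; st_tac.
- move=> m a sa; have sa' := sa; rewrite ker_src in sa'; apply: val_inj.
  rewrite val_ker_gamma ?tgt_one// mor_one -{2}sa' mul1x -zero_one.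
  by rewrite opp_zero -sa' add0x.
- move=> h1 h2 h3 b1 b2 b3 l e12 e23 e1 e2 e3 ll.
  apply: (@twist_conj_loop G N H i s (mor0 s)) => //.
  + exact: kernel_incl_inj.
  + exact: ker_lact_loop.
  + exact: src_ker_phi.
  + exact: src_ker_gamma.
  + exact: val_ker_lact.
  + exact: val_ker_phi.
  + exact: val_ker_gamma.
by split; [exact: val_ker_lact | exact: val_ker_phi | exact: val_ker_gamma].
Qed.

(** The actions in [D] are prescribed only on meaningful arguments, so the claim covers every such
    [D] and not just the one constructed above. *)
Lemma conjugation_data_iso (D : @semidirect_data N H (mor0 s)) :
  conjugation_data D ->
  exists distr : skew_left_distributive (semidirect D),
    isomorphic G (QSB distr).
Proof.
case=> lactE phiE gammaE; have [mor0K morK] := fs.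
pose F := @sd_val_mor G N H i s (mor0 s) D (fun=> erefl) lactE phiE gammaE.
have F_inj : injective F.
  apply: (@sd_val_inj G N H i s f (mor0 s) D (fun=> erefl) lactE) => //.
  - exact: kernel_incl_inj.
  - by move=> a; apply: kerP.
have F_surj : forall x, exists X, F X = x.
  apply: (@sd_val_surj G N H i s f (mor0 s) D (fun=> erefl) lactE) => //.
  - by move=> a; apply: kerP.
  - by move=> v; exists v.
  - by move=> x /in_kernelP kx; exists (exist _ x kx).
have [F' F'K] := choice F_surj.
have FK : cancel F F' by move=> X; apply: F_inj; rewrite F'K.
(* Since [F] is injective and preserves both operations, the law can be checked after applying
   it. *)
have distr : skew_left_distributive (semidirect D).
  move=> X Y Z e1 e2; apply: F_inj.
  have e1' := congr1 (mor0 F) e1; have e2' := congr1 (mor0 F) e2.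
  have e3 : tgt X = src Z by rewrite e1.
  rewrite mor_mul ?mor_add ?skew_distr; [|by st_tac..].
  by rewrite !mor_mul ?mor_opp; st_tac.
exists distr.
have [g g_iso] := @bijective_is_iso (semidirect D) G F id F'
  (fun=> erefl) (fun=> erefl) FK F'K.
by exists g.
Qed.

End Splitting.

Theorem theorem3p18 (G H : qsb) (f : star_mor G H) (s : star_mor H G)
  (f_exact : induces_iso f) (fs : is_splitting f s) :
  (exists D : @semidirect_data (kernel f) H (mor0 s), conjugation_data D) /\
  (forall D : @semidirect_data (kernel f) H (mor0 s), conjugation_data D ->
     exists distr : skew_left_distributive (semidirect D),
       isomorphic G (QSB distr)).
Proof.
split; first exact: conjugation_data_exists.
by move=> D; apply: conjugation_data_iso.
Qed.
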